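(* Let $T=(T,m,e)$ be a cartesian monad on a category $\mathcal{B}$ with pullbacks. Then $\mathsf{Cat}(T,\mathcal{B})$ is the equalizer of the pair of pullback-preserving composite functors $$S^*_-\circ I,\ \Phi\circ I\colon \mathsf{Mod}(\mathcal{S},\mathcal{B})\to[\mathcal{S}_T,\mathcal{B}]\times[\mathcal{S}_{m_0},\mathcal{B}]\times[\mathcal{S}_{m_1},\mathcal{B}]\times[\mathcal{S}_{e_0},\mathcal{B}]\times[\mathcal{S}_{e_1},\mathcal{B}].$$ Moreover, $\mathsf{Cat}(T,\mathcal{B})$ has pullbacks and the canonical functor $\mathsf{Cat}(T,\mathcal{B})\to\mathsf{Mod}(\mathcal{S},\mathcal{B})$ preserves them.
   Context: **Cartesian monads.** A monad $T=(T,m,e)$ (multiplication $m$, unit $e$) is cartesian if $T$ preserves pullbacks and all naturality squares of $m$ and $e$ are pullbacks. **Internal $T$-multicategories.** A $T$-multicategory $x$ internal to $\mathcal{B}$ consists of objects $x_0,x_1$, morphisms $d_1\colon x_1\to Tx_0$ and $d_0\colon x_1\to x_0$, a (specified) pullback $x_2$ of $d_1\colon x_1\to Tx_0$ and $Td_0\colon Tx_1\to Tx_0$ with projections $d_0\colon x_2\to x_1$, $d_2\colon x_2\to Tx_1$, a composition $d_1\colon x_2\to x_1$ with $d_1 d_1=m_{x_0}\,Td_1\,d_2$ and $d_0d_1=d_0d_0$, and a unit $s_0\colon x_0\to x_1$ with $d_1s_0=e_{x_0}$ and $d_0s_0=\mathrm{id}$, together with a (specified) pullback $x_3$ of $d_2\colon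 x_2\to Tx_1$ and $Td_0\colon Tx_2\to Tx_1$, with projections $d_0\colon x_3\to x_2$, $d_3\colon x_3\to Tx_2$. Writing $(g,f)\colon a\to x_2$ for the morphism induced by $g\colon a\to x_1$, $f\colon a\to Tx_1$ with $d_1g=(Td_0)f$, put $s_0=(\mathrm{id},Ts_0\,d_1)$, $s_1=(s_0d_0,e_{x_1})\colon x_1\to x_2$ and $d_1=(d_0d_0,Td_1\,d_3)$, $d_2=(d_1d_0,m_{x_1}\,Td_2\,d_3)\colon x_3\to x_2$. The axioms are $d_1s_0=\mathrm{id}=d_1s_1\colon x_1\to x_1$ and $d_1d_1=d_1d_2\colon x_3\to x_1$. A functor $p\colon x\to y$ is a pair $p_0\colon x_0\to y_0$, $p_1\colon x_1\to y_1$ with $d_0p_1=p_0d_0$, $d_1p_1=(Tp_0)d_1$, $p_1s_0=s_0p_0$, $p_1d_1=d_1p_2$ on $x_2$, where $p_2\colon x_2\to y_2$ is induced by $p_1$ and $Tp_1$ (and $p_3\colon x_3\to y_3$ is induced by $p_2$ and $Tp_2$). These form the category $\mathsf{Cat}(T,\mathcal{B})$. **The sketch $\mathcal{S}$.** It has objects $x_0,x_1,x_2,x_3,x_0',x_1',x_2',x_0'',x_1''$ and generating arrows: $s_0\colon x_0\to x_1$; $s_0,s_1\colon x_1\to x_2$; $d_0\colon x_1\to x_0$; $d_0,d_1\colon x_2\to x_1$; $d_0,d_1,d_2\colon x_3\to x_2$; $d_{1+i}\colon x_{1+i}\to x_i'$ ($i=0,1,2$); $e_i\colon x_i\to x_i'$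 ($i=0,1$); $s_0'\colon x_0'\to x_1'$; $d_0'\colon x_1'\to x_0'$; $d_0',d_1'\colon x_2'\to x_1'$; $d_1'\colon x_1'\to x_0''$; $d_2'\colon x_2'\to x_1''$; $d_0''\colon x_1''\to x_0''$; $m_i\colon x_i''\to x_i'$ ($i=0,1$). Relations (for $i=0,1$ and $0\le j\le i$): $s_1s_0=s_0s_0\colon x_0\to x_2$; $d_{1+i}s_i=e_i\colon x_i\to x_i'$; $d_is_j=\mathrm{id}\colon x_i\to x_i$; $d_0s_0=\mathrm{id}\colon x_1\to x_1$; $d_2s_0=s_0'd_1\colon x_1\to x_1'$; $d_0s_1=s_0d_0\colon x_1\to x_1$; $d_0's_0'=\mathrm{id}\colon x_0'\to x_0'$; $d_{1+i}d_{1+i}=m_id_{1+i}'d_{2+i}\colon x_{2+i}\to x_i'$; $d_{1+i}d_0=d_0'd_{2+i}\colon x_{2+i}\to x_i'$; $d_j'd_{2+i}=d_{1+i}d_j\colon x_{2+i}\to x_i'$; $d_0d_1=d_0d_0\colon x_2\to x_0$; $d_jd_{1+i}=d_id_j\colon x_3\to x_1$; $d_1'd_0'=d_0''d_2'\colon x_2'\to x_0''$; $d_0'd_1'=d_0'd_0'\colon x_2'\to x_0'$. The limit cones require to be pullbacks the squares $d_{1+i}d_0=d_0'd_{2+i}$ exhibiting $x_{2+i}$ as pullback of $d_{1+i}\colon x_{1+i}\to x_i'$ and $d_0'\colon x_{1+i}'\to x_i'$ ($i=0,1$), and the square $d_1'd_0'=d_0''d_2'$ exhibiting $x_2'$ as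 pullback of $d_1'\colon x_1'\to x_0''$ and $d_0''\colon x_1''\to x_0''$. $\mathcal{S}$ also denotes the category generated by this graph and relations; $\mathsf{Mod}(\mathcal{S},\mathcal{B})$ is the full subcategory of $[\mathcal{S},\mathcal{B}]$ on functors sending these cones to pullbacks, with inclusion $I$. For a functor $y\colon\mathcal S\to\mathcal B$ write $y_k,y_k',y_k''$ for its values. **The functors.** $\mathcal{S}_I\subset\mathcal S$ is the subcategory generated by $s_0\colon x_0\to x_1$, $d_0\colon x_1\to x_0$, $d_1\colon x_1\to x_0'$, $d_0,d_1\colon x_2\to x_1$, $d_2\colon x_2\to x_1'$, $d_0'\colon x_1'\to x_0'$; $\mathcal{S}_T$ is the one generated by $s_0'\colon x_0'\to x_1'$, $d_0'\colon x_1'\to x_0'$, $d_1'\colon x_1'\to x_0''$, $d_0',d_1'\colon x_2'\to x_1'$, $d_2'\colon x_2'\to x_1''$, $d_0''\colon x_1''\to x_0''$; adding one prime gives an isomorphism $\mathcal{S}_I\cong\mathcal{S}_T$. $\mathcal{S}_{m_i}$ is generated by $m_i\colon x_i''\to x_i'$ and $\mathcal{S}_{e_i}$ by $e_i\colon x_i\to x_i'$ ($i=0,1$). $S^*_-\colon[\mathcal S,\mathcal B]\to[\mathcal{S}_T,\mathcal{B}]\times\prod_{i=0,1}[\mathcal{S}_{m_i},\mathcal{B}]\times\prod_{i=0,1}[\mathcal{S}_{e_i},\mathcal{B}]$ is the functor whose components are the restriction functors $S^*_T,S^*_{m_i},S^*_{e_i}$. $\Phi$ is the functor with the same source and target whose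 components at $y$ are: in $[\mathcal{S}_T,\mathcal{B}]$, the restriction of $y$ to $\mathcal{S}_I$, transported along $\mathcal{S}_I\cong\mathcal{S}_T$ and composed with $T$; in $[\mathcal{S}_{m_i},\mathcal{B}]$, the arrow $m_{y_i}\colon TTy_i\to Ty_i$; in $[\mathcal{S}_{e_i},\mathcal{B}]$, the arrow $e_{y_i}\colon y_i\to Ty_i$. The canonical functor $\mathsf{Cat}(T,\mathcal B)\to\mathsf{Mod}(\mathcal S,\mathcal B)$ sends $x$ to the model with values $x_k$ ($0\le k\le 3$), $x_k'=Tx_k$ ($0\le k\le2$), $x_i''=TTx_i$ ($i=0,1$), with $s_0'=Ts_0$, $d_j'=Td_j$, $d_0''=TTd_0$, $m_i=m_{x_i}$, $e_i=e_{x_i}$. *)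

(* Defs.v *)
From Corelib Require Import ssreflect.
From Stdlib Require Import FunctionalExtensionality PropExtensionality
  ProofIrrelevance ClassicalEpsilon.

Set Implicit Arguments.
Unset Strict Implicit.
Unset Printing Implicit Defensive.

Declare Scope cat_scope.
Delimit Scope cat_scope with cat.
Local Open Scope cat_scope.

(* Equality of objects and of arrows is Leibniz equality, so that equality of
   functors, and hence the strict equalizer of two functors, makes sense. *)
Record category := Category {
  obj :> Type;
  hom : obj -> obj -> Type;
  idm : forall a, hom a a;
  comp : forall a b c, hom b c -> hom a b -> hom a c;
  compA : forall a b c d (h : hom c d) (g : hom b c) (f : hom a b),
    comp h (comp g f) = comp (comp h g) f;
  comp1m : forall a b (f : hom a b), comp (idm b) f = f;
  compm1 : forall a b (f : hom a b), comp f (idm a) = f }.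
Arguments hom {_} _ _.
Arguments idm {_} _.
Arguments comp {_ _ _ _} _ _.
Notation "g ∘ f" := (comp g f) (at level 40, left associativity) : cat_scope.

Record functor (C D : category) := Functor {
  fobj :> C -> D;
  fmap : forall a b, hom a b -> hom (fobj a) (fobj b);
  fmap1 : forall a, fmap (idm a) = idm (fobj a);
  fmapM : forall a b c (g : hom b c) (f : hom a b),
    fmap (g ∘ f) = fmap g ∘ fmap f }.
Arguments fmap {_ _} _ {_ _} _.

Definition functor_id (C : category) : functor C C :=
  {| fobj := fun a => a; fmap := fun _ _ f => f;
     fmap1 := fun _ => eq_refl; fmapM := fun _ _ _ _ _ => eq_refl |}.

Definition functor_comp (C D E : category) (G : functor D E) (F : functor C D) :
  functor C E.
Proof.
refine {| fobj := fun a => G (F a); fmap := fun _ _ f => fmap G (fmap F f) |}.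
- abstract (by move=> a; rewrite !fmap1).
- abstract (by move=> *; rewrite !fmapM).
Defined.
Notation "G ⊚ F" := (functor_comp G F) (at level 40, left associativity) : cat_scope.

Record nat_trans (C D : category) (F G : functor C D) := NatTrans {
  component :> forall a, hom (F a) (G a);
  naturality : forall a b (f : hom a b),
    component b ∘ fmap F f = fmap G f ∘ component a }.

Lemma nat_trans_eq (C D : category) (F G : functor C D) (s t : nat_trans F G) :
  (forall a, s a = t a) -> s = t.
Proof.
case: s t => [s ns] [t nt] /= st.
have e : s = t by apply: functional_extensionality_dep.
subst t; f_equal; exact: proof_irrelevance.
Qed.

Definition functor_category (C D : category) : category.
Proof.
unshelve refine {| obj := functor C D; hom := fun F G => nat_trans F G;
  idm := fun F => {| component := fun a => idm (F a) |};
  comp := fun F G H t s => {| component := fun a => t a ∘ s a |} |}.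
- abstract (by move=> a b f; rewrite comp1m compm1).
- abstract (by move=> a b f; rewrite -compA naturality compA naturality compA).
- abstract (by move=> *; apply: nat_trans_eq => a /=; rewrite compA).
- abstract (by move=> *; apply: nat_trans_eq => a /=; rewrite comp1m).
- abstract (by move=> *; apply: nat_trans_eq => a /=; rewrite compm1).
Defined.
Notation "⟦ C , D ⟧" := (functor_category C D) : cat_scope.

Definition product_category (C D : category) : category.
Proof.
refine {| obj := (C * D)%type;
  hom := fun a b => (hom (fst a) (fst b) * hom (snd a) (snd b))%type;
  idm := fun a => (idm (fst a), idm (snd a));
  comp := fun a b c g f => (fst g ∘ fst f, snd g ∘ snd f) |}.
- abstract (by move=> *; rewrite /= !compA).
- abstract (by move=> a b [f g]; rewrite /= !comp1m).
- abstract (by move=> a b [f g]; rewrite /= !compm1).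
Defined.
Notation "C ⊗ D" := (product_category C D)
  (at level 41, right associativity) : cat_scope.

Definition functor_pair (A C D : category) (F : functor A C) (G : functor A D) :
  functor A (C ⊗ D).
Proof.
refine {| fobj := fun a => (F a, G a) : obj (C ⊗ D);
  fmap := fun a b f => (fmap F f, fmap G f) : @hom (C ⊗ D) (F a, G a) (F b, G b) |}.
- abstract (by move=> a; rewrite /= !fmap1).
- abstract (by move=> *; rewrite /= !fmapM).
Defined.
Notation "⟨ F , G ⟩" := (functor_pair F G) : cat_scope.

Definition full_subcategory (C : category) (P : C -> Prop) : category.
Proof.
refine {| obj := {a : C | P a};
  hom := fun a b => hom (proj1_sig a) (proj1_sig b);
  idm := fun a => idm (proj1_sig a);
  comp := fun a b c g f => g ∘ f |}.
- exact: (fun _ _ _ _ h g f => compA h g f).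
- exact: (fun _ _ f => comp1m f).
- exact: (fun _ _ f => compm1 f).
Defined.

Definition full_inclusion (C : category) (P : C -> Prop) :
  functor (full_subcategory P) C :=
  {| fobj := fun a : full_subcategory P => proj1_sig a; fmap := fun _ _ f => f;
     fmap1 := fun _ => eq_refl; fmapM := fun _ _ _ _ _ => eq_refl |}.

Definition precomposition (C C' B : category) (F : functor C C') :
  functor ⟦C', B⟧ ⟦C, B⟧.
Proof.
unshelve refine {| fobj := fun y : ⟦C', B⟧ => (y : functor C' B) ⊚ F : ⟦C, B⟧;
  fmap := fun (y z : ⟦C', B⟧) (t : hom y z) =>
    NatTrans (F := (y : functor _ _) ⊚ F) (G := (z : functor _ _) ⊚ F)
      (component := fun a => (t : nat_trans _ _) (F a)) _ |}.
- abstract (by move=> a b f; exact: (naturality t)).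
- abstract (by move=> y; apply: nat_trans_eq).
- abstract (by move=> *; apply: nat_trans_eq).
Defined.

Definition postcomposition (C B B' : category) (G : functor B B') :
  functor ⟦C, B⟧ ⟦C, B'⟧.
Proof.
unshelve refine {| fobj := fun y : ⟦C, B⟧ => G ⊚ (y : functor C B) : ⟦C, B'⟧;
  fmap := fun (y z : ⟦C, B⟧) (t : hom y z) =>
    NatTrans (F := G ⊚ (y : functor _ _)) (G := G ⊚ (z : functor _ _))
      (component := fun a => fmap G ((t : nat_trans _ _) a)) _ |}.
- abstract (by move=> a b f; rewrite /= -!fmapM (naturality t)).
- abstract (by move=> y; apply: nat_trans_eq => a; rewrite /= fmap1).
- abstract (by move=> *; apply: nat_trans_eq => a; rewrite /= fmapM).
Defined.

Definition is_pullback (B : category) (p a b c : B) (p1 : hom p a) (p2 : hom p b)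
  (f : hom a c) (g : hom b c) : Prop :=
  f ∘ p1 = g ∘ p2 /\
  forall (z : B) (u : hom z a) (v : hom z b), f ∘ u = g ∘ v ->
    exists! w : hom z p, p1 ∘ w = u /\ p2 ∘ w = v.

Definition has_pullbacks (B : category) : Prop :=
  forall (a b c : B) (f : hom a c) (g : hom b c),
  exists (p : B) (p1 : hom p a) (p2 : hom p b), is_pullback p1 p2 f g.

Definition preserves_pullbacks (C D : category) (F : functor C D) : Prop :=
  forall (p a b c : C) (p1 : hom p a) (p2 : hom p b) (f : hom a c) (g : hom b c),
  is_pullback p1 p2 f g ->
  is_pullback (fmap F p1) (fmap F p2) (fmap F f) (fmap F g).

(* The equalizer in the category of categories and functors, on the nose. *)
Definition is_equalizer (E C D : category) (K : functor E C) (F G : functor C D) :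
  Prop :=
  F ⊚ K = G ⊚ K /\
  forall (A : category) (H : functor A C), F ⊚ H = G ⊚ H ->
    exists! L : functor A E, K ⊚ L = H.

Section PullbackPairing.
Context {B : category} {p a b c : B} {p1 : hom p a} {p2 : hom p b}
  {f : hom a c} {g : hom b c}.

Definition pairing (pb : is_pullback p1 p2 f g) (z : B) (u : hom z a)
  (v : hom z b) (e : f ∘ u = g ∘ v) : hom z p :=
  proj1_sig (constructive_definite_description _ (proj2 pb z u v e)).

Lemma pairing1 (pb : is_pullback p1 p2 f g) z (u : hom z a) (v : hom z b)
  (e : f ∘ u = g ∘ v) : p1 ∘ pairing pb e = u.
Proof. by rewrite /pairing; case: constructive_definite_description => w []. Qed.

Lemma pairing2 (pb : is_pullback p1 p2 f g) z (u : hom z a) (v : hom z b)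
  (e : f ∘ u = g ∘ v) : p2 ∘ pairing pb e = v.
Proof. by rewrite /pairing; case: constructive_definite_description => w []. Qed.

Lemma pullback_ext (pb : is_pullback p1 p2 f g) z (w w' : hom z p) :
  p1 ∘ w = p1 ∘ w' -> p2 ∘ w = p2 ∘ w' -> w = w'.
Proof.
case: pb => sq univ e1 e2.
have e : f ∘ (p1 ∘ w') = g ∘ (p2 ∘ w') by rewrite !compA sq.
case: (univ _ _ _ e) => w0 [_ uniq].
by rewrite -(uniq w (conj e1 e2)) -(uniq w' (conj eq_refl eq_refl)).
Qed.
End PullbackPairing.

Record monad (B : category) := Monad {
  mfun :> functor B B;
  mmul : nat_trans (mfun ⊚ mfun) mfun;
  munit : nat_trans (functor_id B) mfun;
  mmulA : forall a, mmul a ∘ fmap mfun (mmul a) = mmul a ∘ mmul (mfun a);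
  mmul1m : forall a, mmul a ∘ munit (mfun a) = idm (mfun a);
  mmulm1 : forall a, mmul a ∘ fmap mfun (munit a) = idm (mfun a) }.

Definition cartesian_nat_trans (C D : category) (F G : functor C D)
  (t : nat_trans F G) : Prop :=
  forall (a b : C) (f : hom a b), is_pullback (fmap F f) (t a) (t b) (fmap G f).

Definition cartesian_monad (B : category) (T : monad B) : Prop :=
  preserves_pullbacks T /\ cartesian_nat_trans (mmul T) /\
  cartesian_nat_trans (munit T).

(* Arrows are named after the simplicial notation, the suffix being the index
   of the source: [cd1_2] is d_1 : x_2 -> x_1. *)
Record pre_multicategory (B : category) (T : monad B) := PreMulticategory {
  cob0 : B; cob1 : B; cob2 : B; cob3 : B;
  cd1_1 : hom cob1 (T cob0);
  cd0_1 : hom cob1 cob0;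
  cd0_2 : hom cob2 cob1;
  cd2_2 : hom cob2 (T cob1);
  cpb2 : is_pullback cd0_2 cd2_2 cd1_1 (fmap T cd0_1);
  cd1_2 : hom cob2 cob1;
  cd1_1_cd1_2 : cd1_1 ∘ cd1_2 = mmul T cob0 ∘ fmap T cd1_1 ∘ cd2_2;
  cd0_1_cd1_2 : cd0_1 ∘ cd1_2 = cd0_1 ∘ cd0_2;
  cs0_0 : hom cob0 cob1;
  cd1_1_cs0_0 : cd1_1 ∘ cs0_0 = munit T cob0;
  cd0_1_cs0_0 : cd0_1 ∘ cs0_0 = idm cob0;
  cd0_3 : hom cob3 cob2;
  cd3_3 : hom cob3 (T cob2);
  cpb3 : is_pullback cd0_3 cd3_3 cd2_2 (fmap T cd0_2) }.

Section DerivedArrows.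
Context {B : category} {T : monad B} (x : pre_multicategory T).

Let nat_m (a b : B) (f : hom a b) :
  mmul T b ∘ fmap T (fmap T f) = fmap T f ∘ mmul T a := naturality (mmul T) f.
Let nat_e (a b : B) (f : hom a b) : munit T b ∘ f = fmap T f ∘ munit T a :=
  naturality (munit T) f.

Lemma cs0_1_subproof :
  cd1_1 x ∘ idm _ = fmap T (cd0_1 x) ∘ (fmap T (cs0_0 x) ∘ cd1_1 x).
Proof. by rewrite compA -fmapM cd0_1_cs0_0 fmap1 comp1m compm1. Qed.
Definition cs0_1 : hom (cob1 x) (cob2 x) := pairing (cpb2 x) cs0_1_subproof.

Lemma cs1_1_subproof :
  cd1_1 x ∘ (cs0_0 x ∘ cd0_1 x) = fmap T (cd0_1 x) ∘ munit T (cob1 x).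
Proof. by rewrite compA cd1_1_cs0_0 nat_e. Qed.
Definition cs1_1 : hom (cob1 x) (cob2 x) := pairing (cpb2 x) cs1_1_subproof.

Lemma cd1_3_subproof :
  cd1_1 x ∘ (cd0_2 x ∘ cd0_3 x) = fmap T (cd0_1 x) ∘ (fmap T (cd1_2 x) ∘ cd3_3 x).
Proof.
rewrite compA (proj1 (cpb2 x)) -compA (proj1 (cpb3 x)) !compA -!fmapM.
by rewrite cd0_1_cd1_2.
Qed.
Definition cd1_3 : hom (cob3 x) (cob2 x) := pairing (cpb2 x) cd1_3_subproof.

Lemma cd2_3_subproof :
  cd1_1 x ∘ (cd1_2 x ∘ cd0_3 x) =
  fmap T (cd0_1 x) ∘ (mmul T (cob1 x) ∘ fmap T (cd2_2 x) ∘ cd3_3 x).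
Proof.
rewrite compA cd1_1_cd1_2 -!compA (proj1 (cpb3 x)) !compA -nat_m.
by rewrite -!(compA (mmul T _)) -!fmapM (proj1 (cpb2 x)).
Qed.
Definition cd2_3 : hom (cob3 x) (cob2 x) := pairing (cpb2 x) cd2_3_subproof.
End DerivedArrows.

Record multicategory (B : category) (T : monad B) := Multicategory {
  mpre :> pre_multicategory T;
  cd1_2_cs0_1 : cd1_2 mpre ∘ cs0_1 mpre = idm (cob1 mpre);
  cd1_2_cs1_1 : cd1_2 mpre ∘ cs1_1 mpre = idm (cob1 mpre);
  cd1_2_cd1_3 : cd1_2 mpre ∘ cd1_3 mpre = cd1_2 mpre ∘ cd2_3 mpre }.

Record pre_multifunctor (B : category) (T : monad B) (x y : pre_multicategory T) :=
  PreMultifunctor {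
  mf0 : hom (cob0 x) (cob0 y);
  mf1 : hom (cob1 x) (cob1 y);
  mf_d0_1 : cd0_1 y ∘ mf1 = mf0 ∘ cd0_1 x;
  mf_d1_1 : cd1_1 y ∘ mf1 = fmap T mf0 ∘ cd1_1 x }.

Lemma mf2_subproof (B : category) (T : monad B) (x y : pre_multicategory T)
  (p : pre_multifunctor x y) :
  cd1_1 y ∘ (mf1 p ∘ cd0_2 x) = fmap T (cd0_1 y) ∘ (fmap T (mf1 p) ∘ cd2_2 x).
Proof.
by rewrite compA mf_d1_1 -compA (proj1 (cpb2 x)) !compA -!fmapM mf_d0_1.
Qed.
Definition mf2 (B : category) (T : monad B) (x y : pre_multicategory T)
  (p : pre_multifunctor x y) : hom (cob2 x) (cob2 y) :=
  pairing (cpb2 y) (mf2_subproof p).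

Lemma mf3_subproof (B : category) (T : monad B) (x y : pre_multicategory T)
  (p : pre_multifunctor x y) :
  cd2_2 y ∘ (mf2 p ∘ cd0_3 x) = fmap T (cd0_2 y) ∘ (fmap T (mf2 p) ∘ cd3_3 x).
Proof.
rewrite compA pairing2 -compA (proj1 (cpb3 x)) !compA -!fmapM.
by rewrite pairing1.
Qed.
Definition mf3 (B : category) (T : monad B) (x y : pre_multicategory T)
  (p : pre_multifunctor x y) : hom (cob3 x) (cob3 y) :=
  pairing (cpb3 y) (mf3_subproof p).

Record multifunctor (B : category) (T : monad B) (x y : multicategory T) :=
  Multifunctor {
  mfpre :> pre_multifunctor x y;
  mf_s0_0 : mf1 mfpre ∘ cs0_0 x = cs0_0 y ∘ mf0 mfpre;
  mf_d1_2 : mf1 mfpre ∘ cd1_2 x = cd1_2 y ∘ mf2 mfpre }.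

Section MultifunctorCategory.
Context {B : category} {T : monad B}.
Implicit Types x y z : multicategory T.

Lemma multifunctor_eq x y (p q : multifunctor x y) :
  mf0 p = mf0 q -> mf1 p = mf1 q -> p = q.
Proof.
case: p q => [[p0 p1 a b] c d] [[q0 q1 a' b'] c' d'] /= e0 e1.
subst q0 q1.
have e := proof_irrelevance _ a a'; subst a'.
have e := proof_irrelevance _ b b'; subst b'.
by f_equal; apply: proof_irrelevance.
Qed.

Definition pre_multifunctor_id x : pre_multifunctor x x.
Proof.
refine {| mf0 := idm (cob0 x); mf1 := idm (cob1 x) |}.
- abstract (by rewrite comp1m compm1).
- abstract (by rewrite fmap1 comp1m compm1).
Defined.

Definition pre_multifunctor_comp x y z (q : pre_multifunctor y z)
  (p : pre_multifunctor x y) : pre_multifunctor x z.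
Proof.
refine {| mf0 := mf0 q ∘ mf0 p; mf1 := mf1 q ∘ mf1 p |}.
- abstract (by rewrite compA mf_d0_1 -compA mf_d0_1 compA).
- abstract (by rewrite compA mf_d1_1 -compA mf_d1_1 compA -fmapM).
Defined.

Lemma mf2_id x : mf2 (pre_multifunctor_id x) = idm (cob2 x).
Proof.
by apply: (pullback_ext (cpb2 x)); rewrite ?pairing1 ?pairing2 /=
  ?fmap1 comp1m compm1.
Qed.

Lemma mf3_id x : mf3 (pre_multifunctor_id x) = idm (cob3 x).
Proof.
by apply: (pullback_ext (cpb3 x)); rewrite ?pairing1 ?pairing2 /=
  mf2_id ?fmap1 comp1m compm1.
Qed.

Lemma mf2_comp x y z (q : pre_multifunctor y z) (p : pre_multifunctor x y) :
  mf2 (pre_multifunctor_comp q p) = mf2 q ∘ mf2 p.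
Proof.
apply: (pullback_ext (cpb2 z)); rewrite ?compA ?pairing1 ?pairing2 /=.
  by rewrite -!compA pairing1.
by rewrite -!compA pairing2 fmapM -!compA.
Qed.

Lemma mf3_comp x y z (q : pre_multifunctor y z) (p : pre_multifunctor x y) :
  mf3 (pre_multifunctor_comp q p) = mf3 q ∘ mf3 p.
Proof.
apply: (pullback_ext (cpb3 z)); rewrite ?compA ?pairing1 ?pairing2 mf2_comp.
  by rewrite -!compA pairing1.
by rewrite -!compA pairing2 fmapM -!compA.
Qed.

Definition multifunctor_id x : multifunctor x x.
Proof.
refine {| mfpre := pre_multifunctor_id x |}.
- abstract (by rewrite comp1m compm1).
- abstract (by rewrite mf2_id comp1m compm1).
Defined.

Definition multifunctor_comp x y z (q : multifunctor y z) (p : multifunctor x y) :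
  multifunctor x z.
Proof.
refine {| mfpre := pre_multifunctor_comp q p |}.
- abstract (by rewrite /= -compA mf_s0_0 compA mf_s0_0 compA).
- abstract (by rewrite mf2_comp /= -compA mf_d1_2 compA mf_d1_2 compA).
Defined.
End MultifunctorCategory.

Definition Cat (B : category) (T : monad B) : category.
Proof.
refine {| obj := multicategory T; hom := fun x y => multifunctor x y;
  idm := multifunctor_id; comp := fun _ _ _ q p => multifunctor_comp q p |}.
- abstract (by move=> *; apply: multifunctor_eq; rewrite /= compA).
- abstract (by move=> *; apply: multifunctor_eq; rewrite /= comp1m).
- abstract (by move=> *; apply: multifunctor_eq; rewrite /= compm1).
Defined.

Definition quotient (A : Type) (R : A -> A -> Prop) : Type :=
  {P : A -> Prop | exists a, P = R a}.

Section Quotient.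
Context {A : Type} (R : A -> A -> Prop).

Definition class_of (a : A) : quotient R :=
  exist _ (R a) (ex_intro _ a eq_refl).

Definition repr (c : quotient R) : A :=
  proj1_sig (constructive_indefinite_description _ (proj2_sig c)).

Lemma reprK (c : quotient R) : class_of (repr c) = c.
Proof.
rewrite /class_of /repr; case: constructive_indefinite_description => a.
case: c => P eP /= Pa; subst P; f_equal; exact: proof_irrelevance.
Qed.

Context (R_refl : forall a, R a a).
Context (R_sym : forall a b, R a b -> R b a).
Context (R_trans : forall a b c, R a b -> R b c -> R a c).

Lemma class_of_eq (a b : A) : R a b -> class_of a = class_of b.
Proof.
move=> ab; have e : R a = R b.
  apply: functional_extensionality => c; apply: propositional_extensionality.
  by split; [move/(R_trans (R_sym ab)) | move/(R_trans ab)].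
rewrite /class_of; move: (ex_intro _ a _) (ex_intro _ b _).
rewrite e => u v; f_equal; exact: proof_irrelevance.
Qed.

Lemma class_of_inj (a b : A) : class_of a = class_of b -> R a b.
Proof. by move=> [] ->; apply: R_refl. Qed.
End Quotient.

Inductive path (V : Type) (E : V -> V -> Type) (a : V) : V -> Type :=
| pnil : path E a a
| pcons b c : E b c -> path E a b -> path E a c.
Arguments pnil {V E a}.
Arguments pcons {V E a b c} _ _.
Notation "f ∙ p" := (pcons f p) (at level 39, right associativity) : cat_scope.
Notation "'ε'" := pnil : cat_scope.

Fixpoint pcat V (E : V -> V -> Type) (a b c : V) (q : path E b c) :
  path E a b -> path E a c :=
  match q in path _ _ c return path E a b -> path E a c with
  | ε => fun p => p
  | f ∙ q' => fun p => f ∙ pcat q' p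
  end.

Lemma pcatA V (E : V -> V -> Type) (a b c d : V) (r : path E c d)
  (q : path E b c) (p : path E a b) : pcat r (pcat q p) = pcat (pcat r q) p.
Proof. by elim: r => //= c' d' f r ->. Qed.

Lemma pcatp1 V (E : V -> V -> Type) (a b : V) (p : path E a b) : pcat p ε = p.
Proof. by elim: p => //= c' d' f r ->. Qed.

Section Presentation.
Context {V : Type} {E : V -> V -> Type}.
Context (R : forall a b, path E a b -> path E a b -> Prop).

(* The congruence generated by the relations. *)
Inductive path_eq : forall a b, path E a b -> path E a b -> Prop :=
| path_eq_rel a b (p q : path E a b) : R p q -> path_eq p q
| path_eq_refl a b (p : path E a b) : path_eq p p
| path_eq_sym a b (p q : path E a b) : path_eq p q -> path_eq q p
| path_eq_trans a b (p q r : path E a b) :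
    path_eq p q -> path_eq q r -> path_eq p r
| path_eq_cat a b c (q q' : path E b c) (p p' : path E a b) :
    path_eq q q' -> path_eq p p' -> path_eq (pcat q p) (pcat q' p').

Definition path_class (a b : V) (p : path E a b) : quotient (@path_eq a b) :=
  class_of _ p.

Lemma path_class_eq (a b : V) (p q : path E a b) :
  path_class p = path_class q <-> path_eq p q.
Proof.
split; first exact: (class_of_inj (@path_eq_refl a b)).
exact: (class_of_eq (@path_eq_sym a b) (@path_eq_trans a b)).
Qed.

Lemma path_classP (a b : V) (f : quotient (@path_eq a b)) :
  exists p, f = path_class p.
Proof. by exists (repr f); rewrite /path_class reprK. Qed.

Definition path_class_comp (a b c : V) (g : quotient (@path_eq b c))
  (f : quotient (@path_eq a b)) : quotient (@path_eq a c) :=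
  path_class (pcat (repr g) (repr f)).

Lemma path_class_compE (a b c : V) (q : path E b c) (p : path E a b) :
  path_class_comp (path_class q) (path_class p) = path_class (pcat q p).
Proof.
by apply/path_class_eq; apply: path_eq_cat; apply/path_class_eq; apply: reprK.
Qed.

Definition presented_category : category.
Proof.
refine {| obj := V; hom := fun a b => quotient (@path_eq a b);
  idm := fun a => path_class ε; comp := path_class_comp |}.
- abstract (by move=> a b c d h g f; case: (path_classP h) => r ->;
    case: (path_classP g) => q ->; case: (path_classP f) => p ->;
    rewrite !path_class_compE pcatA).
- abstract (by move=> a b f; case: (path_classP f) => p ->; rewrite path_class_compE).
- abstract (by move=> a b f; case: (path_classP f) => p ->; rewrite path_class_compE pcatp1).
Defined.

Definition generator (a b : V) (f : E a b) : @hom presented_category a b :=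
  path_class (f ∙ ε).
End Presentation.

(* A diagram of shape (V, E): a graph morphism into the underlying graph of C. *)
Record diagram (V : Type) (E : V -> V -> Type) (C : category) := Diagram {
  dob :> V -> C;
  darr : forall a b, E a b -> hom (dob a) (dob b) }.
Arguments darr {V E C} _ {a b} _.

Fixpoint deval V (E : V -> V -> Type) (C : category) (D : diagram E C) (a b : V)
  (p : path E a b) : hom (D a) (D b) :=
  match p in path _ _ b return hom (D a) (D b) with
  | ε => idm (D a)
  | f ∙ q => darr D f ∘ deval D q
  end.

Lemma deval_cat V (E : V -> V -> Type) (C : category) (D : diagram E C)
  (a b c : V) (q : path E b c) (p : path E a b) :
  deval D (pcat q p) = deval D q ∘ deval D p.
Proof. by elim: q => [|c' d f q IH] /=; rewrite ?comp1m // IH compA. Qed.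

Section FromPresented.
Context {V : Type} {E : V -> V -> Type}.
Context {R : forall a b, path E a b -> path E a b -> Prop}.
Local Notation S := (presented_category R).

Lemma deval_generator (a b : V) (p : path E a b) :
  deval (Diagram (C := S) (dob := fun v => v) (@generator _ _ R)) p
    = path_class R p.
Proof. by elim: p => //= c d f p ->; rewrite path_class_compE. Qed.

Section Functor.
Context {C : category} (D : diagram E C).
Context (DR : forall a b (p q : path E a b), R p q -> deval D p = deval D q).

Lemma deval_path_eq (a b : V) (p q : path E a b) :
  path_eq R p q -> deval D p = deval D q.
Proof.
elim=> {a b p q} [||a b p q _ ->|a b p q r _ -> _ ->|a b c q q' p p' _ eq _ ep] //.
by rewrite !deval_cat eq ep.
Qed.

Lemma deval_repr (a b : V) (p : path E a b) :
  deval D (repr (path_class R p)) = deval D p.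
Proof. by apply: deval_path_eq; apply/path_class_eq; apply: reprK. Qed.

Definition presented_functor : functor S C.
Proof.
refine {| fobj := fun a : S => D a; fmap := fun a b f => deval D (repr f) |}.
- abstract (by move=> a; apply: deval_repr).
- abstract (by move=> a b c g f;
    rewrite /comp /= /path_class_comp deval_repr deval_cat).
Defined.

Lemma presented_functor_class (a b : V) (p : path E a b) :
  @fmap _ _ presented_functor a b (path_class R p) = deval D p.
Proof. exact: deval_repr. Qed.

Lemma presented_functor_generator (a b : V) (f : E a b) :
  fmap presented_functor (generator R f) = darr D f.
Proof. by rewrite /generator presented_functor_class /= compm1. Qed.
End Functor.

Definition presented_nat_trans (C : category) (F G : functor S C)
  (t : forall a : V, hom (F a) (G a))
  (nt : forall (a b : V) (f : E a b),
    t b ∘ fmap F (generator R f) = fmap G (generator R f) ∘ t a) :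
  nat_trans F G.
Proof.
refine {| component := t : forall a : S, hom (F a) (G a) |}.
abstract (
  move=> a b f; case: (path_classP f) => p ->; rewrite -deval_generator;
  elim: p => [|c d g p IH] /=;
  [ by rewrite (fmap1 F) (fmap1 G) comp1m compm1
  | by rewrite (fmapM F) (fmapM G) compA nt -!compA IH ]).
Defined.
End FromPresented.

(* For an injective diagram this is the subcategory generated by its arrows;
   its objects are the vertices of the shape, and its arrows are those arrows
   of C that are composites of arrows of the diagram. *)
Definition generated_hom V (E : V -> V -> Type) (C : category) (D : diagram E C)
  (a b : V) : Type :=
  {f : hom (D a) (D b) | exists p : path E a b, f = deval D p}.

Section Generated.
Context {V : Type} {E : V -> V -> Type} {C : category} (D : diagram E C).

Lemma generated_hom_eq (a b : V) (f g : generated_hom D a b) :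
  proj1_sig f = proj1_sig g -> f = g.
Proof.
case: f g => [f pf] [g pg] /= e; subst g; f_equal; exact: proof_irrelevance.
Qed.

Definition generated_arrow (a b : V) (p : path E a b) : generated_hom D a b :=
  exist _ (deval D p) (ex_intro _ p eq_refl).

Definition generated_path (a b : V) (f : generated_hom D a b) : path E a b :=
  proj1_sig (constructive_indefinite_description _ (proj2_sig f)).

Lemma generated_pathK (a b : V) (f : generated_hom D a b) :
  generated_arrow (generated_path f) = f.
Proof.
apply: generated_hom_eq; rewrite /generated_path /=.
by case: constructive_indefinite_description.
Qed.

Lemma deval_generated_pathE (a b : V) (f : generated_hom D a b) :
  deval D (generated_path f) = proj1_sig f.
Proof. exact: (f_equal (@proj1_sig _ _) (generated_pathK f)). Qed.

Definition generated_subcategory : category.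
Proof.
unshelve refine {| obj := V; hom := fun a b => generated_hom D a b;
  idm := fun a => exist _ (idm (D a)) _;
  comp := fun a b c g f => exist _ (proj1_sig g ∘ proj1_sig f) _ |}.
- abstract (by exists ε).
- abstract (by exists (pcat (generated_path g) (generated_path f));
    rewrite deval_cat !deval_generated_pathE).
- abstract (by move=> *; apply: generated_hom_eq; rewrite /= compA).
- abstract (by move=> *; apply: generated_hom_eq; rewrite /= comp1m).
- abstract (by move=> *; apply: generated_hom_eq; rewrite /= compm1).
Defined.

Definition generated_inclusion : functor generated_subcategory C :=
  {| fobj := fun a : generated_subcategory => D a;
     fmap := fun _ _ f => proj1_sig f;
     fmap1 := fun _ => eq_refl; fmapM := fun _ _ _ _ _ => eq_refl |}.

(* A diagram D' of the same shape that identifies all the composites that D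
   identifies is a functor on the subcategory generated by D. *)
Section Functor.
Context {C' : category} (D' : diagram E C').
Hypothesis DD' : forall a b (p q : path E a b),
  deval D p = deval D q -> deval D' p = deval D' q.

Lemma deval_generated_path (a b : V) (p : path E a b) (f : generated_hom D a b) :
  proj1_sig f = deval D p -> deval D' (generated_path f) = deval D' p.
Proof. by move=> e; apply: DD'; rewrite deval_generated_pathE. Qed.

Definition generated_functor : functor generated_subcategory C'.
Proof.
refine {| fobj := fun a : generated_subcategory => D' a;
  fmap := fun a b (f : generated_hom D a b) => deval D' (generated_path f) |}.
- abstract (by move=> a; rewrite (deval_generated_path (p := ε))).
- abstract (by move=> a b c g f; rewrite -deval_cat; apply: deval_generated_path;
    rewrite deval_cat !deval_generated_pathE).
Defined.

Lemma generated_functor_arrow (a b : V) (p : path E a b) :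
  @fmap _ _ generated_functor a b (generated_arrow p) = deval D' p.
Proof. exact: deval_generated_path. Qed.
End Functor.

Section NatTrans.
Context {B : category} {F G : functor generated_subcategory B}.
Context (t : forall a : V, hom (F a) (G a)).
Context (nt : forall (a b : V) (f : E a b),
  t b ∘ fmap F (generated_arrow (f ∙ ε)) = fmap G (generated_arrow (f ∙ ε)) ∘ t a).

Lemma generated_naturality (a b : V) (f : generated_hom D a b) :
  t b ∘ fmap F f = fmap G f ∘ t a.
Proof.
have H1 (H : functor generated_subcategory B) (c : V) :
    fmap H (generated_arrow ε) = idm (H c).
  by rewrite -(fmap1 H); f_equal; apply: generated_hom_eq.
have HM (H : functor generated_subcategory B) (c d e : V) (g : E d e)
    (p : path E c d) : fmap H (generated_arrow (g ∙ p)) =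
  @comp B (H c) (H d) (H e) (fmap H (generated_arrow (g ∙ ε)))
    (fmap H (generated_arrow p)).
  by rewrite -(fmapM H); f_equal; apply: generated_hom_eq; rewrite /= compm1.
rewrite -(generated_pathK f); elim: (generated_path f) => [|c d g p IH].
  by rewrite !H1 comp1m compm1.
by rewrite (HM F) (HM G) compA nt -!compA IH.
Qed.

Definition generated_nat_trans : nat_trans F G :=
  NatTrans (F := F) (G := G) generated_naturality.
End NatTrans.
End Generated.

Inductive S_ob := x0 | x1 | x2 | x3 | x0' | x1' | x2' | x0'' | x1''.

(* As above, the suffix is the index of the source. *)
Inductive S_edge : S_ob -> S_ob -> Type :=
| s0_0 : S_edge x0 x1
| s0_1 : S_edge x1 x2
| s1_1 : S_edge x1 x2
| d0_1 : S_edge x1 x0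
| d0_2 : S_edge x2 x1
| d1_2 : S_edge x2 x1
| d0_3 : S_edge x3 x2
| d1_3 : S_edge x3 x2
| d2_3 : S_edge x3 x2
| d1_1 : S_edge x1 x0'
| d2_2 : S_edge x2 x1'
| d3_3 : S_edge x3 x2'
| e_0 : S_edge x0 x0'
| e_1 : S_edge x1 x1'
| s0'_0 : S_edge x0' x1'
| d0'_1 : S_edge x1' x0'
| d0'_2 : S_edge x2' x1'
| d1'_2 : S_edge x2' x1'
| d1'_1 : S_edge x1' x0''
| d2'_2 : S_edge x2' x1''
| d0''_1 : S_edge x1'' x0''
| m_0 : S_edge x0'' x0'
| m_1 : S_edge x1'' x1'.

(* Instances of one family of relations, for i = 0, 1 and 0 <= j <= i, share
   a name up to the suffix i or ij; repeated instances are omitted: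
   d_0' d_2 = d_1 d_0 and d_0' d_3 = d_2 d_0 (the case j = 0 of
   d_j' d_{2+i} = d_{1+i} d_j) are [rel_dd'_0] and [rel_dd'_1]. *)
Inductive S_rel : forall a b, path S_edge a b -> path S_edge a b -> Prop :=
| rel_s1s0 : S_rel (s1_1 ∙ s0_0 ∙ ε) (s0_1 ∙ s0_0 ∙ ε)
| rel_e_0 : S_rel (d1_1 ∙ s0_0 ∙ ε) (e_0 ∙ ε)
| rel_e_1 : S_rel (d2_2 ∙ s1_1 ∙ ε) (e_1 ∙ ε)
| rel_ds_00 : S_rel (d0_1 ∙ s0_0 ∙ ε) ε
| rel_ds_10 : S_rel (d1_2 ∙ s0_1 ∙ ε) ε
| rel_ds_11 : S_rel (d1_2 ∙ s1_1 ∙ ε) ε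
| rel_d0s0 : S_rel (d0_2 ∙ s0_1 ∙ ε) ε
| rel_d2s0 : S_rel (d2_2 ∙ s0_1 ∙ ε) (s0'_0 ∙ d1_1 ∙ ε)
| rel_d0s1 : S_rel (d0_2 ∙ s1_1 ∙ ε) (s0_0 ∙ d0_1 ∙ ε)
| rel_d0's0' : S_rel (d0'_1 ∙ s0'_0 ∙ ε) ε
| rel_m_0 : S_rel (d1_1 ∙ d1_2 ∙ ε) (m_0 ∙ d1'_1 ∙ d2_2 ∙ ε)
| rel_m_1 : S_rel (d2_2 ∙ d2_3 ∙ ε) (m_1 ∙ d2'_2 ∙ d3_3 ∙ ε)
| rel_dd'_0 : S_rel (d1_1 ∙ d0_2 ∙ ε) (d0'_1 ∙ d2_2 ∙ ε)
| rel_dd'_1 : S_rel (d2_2 ∙ d0_3 ∙ ε) (d0'_2 ∙ d3_3 ∙ ε)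
| rel_d'd_11 : S_rel (d1'_2 ∙ d3_3 ∙ ε) (d2_2 ∙ d1_3 ∙ ε)
| rel_d0d1 : S_rel (d0_1 ∙ d1_2 ∙ ε) (d0_1 ∙ d0_2 ∙ ε)
| rel_dd_00 : S_rel (d0_2 ∙ d1_3 ∙ ε) (d0_2 ∙ d0_3 ∙ ε)
| rel_dd_10 : S_rel (d0_2 ∙ d2_3 ∙ ε) (d1_2 ∙ d0_3 ∙ ε)
| rel_dd_11 : S_rel (d1_2 ∙ d2_3 ∙ ε) (d1_2 ∙ d1_3 ∙ ε)
| rel_d1'd0' : S_rel (d1'_1 ∙ d0'_2 ∙ ε) (d0''_1 ∙ d2'_2 ∙ ε)
| rel_d0'd1' : S_rel (d0'_1 ∙ d1'_2 ∙ ε) (d0'_1 ∙ d0'_2 ∙ ε).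

Definition S : category := presented_category S_rel.

Definition gen (a b : S_ob) (f : S_edge a b) : @hom S a b := generator S_rel f.

Definition gen_diagram : diagram S_edge S :=
  Diagram (C := S) (dob := fun v => v) gen.

Lemma S_relE (a b : S_ob) (p q : path S_edge a b) :
  S_rel p q -> deval gen_diagram p = deval gen_diagram q.
Proof.
move=> r; rewrite /gen_diagram !deval_generator.
by apply/path_class_eq; apply: path_eq_rel.
Qed.

Section Models.
Context (B : category).

Definition is_model (y : ⟦S, B⟧) : Prop :=
  let ym := fun a b (f : S_edge a b) => fmap (y : functor S B) (gen f) in
  is_pullback (ym _ _ d0_2) (ym _ _ d2_2) (ym _ _ d1_1) (ym _ _ d0'_1) /\
  is_pullback (ym _ _ d0_3) (ym _ _ d3_3) (ym _ _ d2_2) (ym _ _ d0'_2) /\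
  is_pullback (ym _ _ d0'_2) (ym _ _ d2'_2) (ym _ _ d1'_1) (ym _ _ d0''_1).

Definition Mod : category := full_subcategory is_model.
Definition Mod_inclusion : functor Mod ⟦S, B⟧ := full_inclusion is_model.
End Models.

(* The common shape of the graphs generating S_I and S_T. *)
Inductive IT_ob := it0 | it1 | it2 | it0' | it1'.

Inductive IT_edge : IT_ob -> IT_ob -> Type :=
| it_s0_0 : IT_edge it0 it1
| it_d0_1 : IT_edge it1 it0
| it_d1_1 : IT_edge it1 it0'
| it_d0_2 : IT_edge it2 it1
| it_d1_2 : IT_edge it2 it1
| it_d2_2 : IT_edge it2 it1'
| it_d0'_1 : IT_edge it1' it0'.

Definition ob_I (a : IT_ob) : S :=
  match a with
  | it0 => x0 | it1 => x1 | it2 => x2 | it0' => x0' | it1' => x1'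
  end.

Definition ob_T (a : IT_ob) : S :=
  match a with
  | it0 => x0' | it1 => x1' | it2 => x2' | it0' => x0'' | it1' => x1''
  end.

Definition diagram_I : diagram IT_edge S :=
  Diagram (dob := ob_I) (fun a b f =>
    match f in IT_edge a b return hom (ob_I a) (ob_I b) with
    | it_s0_0 => gen s0_0
    | it_d0_1 => gen d0_1
    | it_d1_1 => gen d1_1
    | it_d0_2 => gen d0_2
    | it_d1_2 => gen d1_2
    | it_d2_2 => gen d2_2
    | it_d0'_1 => gen d0'_1
    end).

Definition diagram_T : diagram IT_edge S :=
  Diagram (dob := ob_T) (fun a b f =>
    match f in IT_edge a b return hom (ob_T a) (ob_T b) with
    | it_s0_0 => gen s0'_0
    | it_d0_1 => gen d0'_1
    | it_d1_1 => gen d1'_1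
    | it_d0_2 => gen d0'_2
    | it_d1_2 => gen d1'_2
    | it_d2_2 => gen d2'_2
    | it_d0'_1 => gen d0''_1
    end).

Definition S_I : category := generated_subcategory diagram_I.
Definition S_T : category := generated_subcategory diagram_T.

(* Removing one prime, as a partial operation on the paths of S.  It respects
   the relations between paths with a primed source. *)
Definition unprime_ob (a : S_ob) : S :=
  match a with
  | x0' => x0 | x1' => x1 | x2' => x2 | x0'' => x0' | x1'' => x1' | a => a
  end.

Definition unprime_edge (a b : S_ob) (f : S_edge a b) :
  option (hom (unprime_ob a) (unprime_ob b)) :=
  match f in S_edge a b return option (hom (unprime_ob a) (unprime_ob b)) with
  | s0'_0 => Some (gen s0_0)
  | d0'_1 => Some (gen d0_1)
  | d1'_1 => Some (gen d1_1)
  | d0'_2 => Some (gen d0_2)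
  | d1'_2 => Some (gen d1_2)
  | d2'_2 => Some (gen d2_2)
  | d0''_1 => Some (gen d0'_1)
  | _ => None
  end.

Definition ocomp (C : category) (a b c : C) (g : option (hom b c))
  (f : option (hom a b)) : option (hom a c) :=
  match g, f with Some g, Some f => Some (g ∘ f) | _, _ => None end.

Fixpoint unprime_path (a b : S_ob) (p : path S_edge a b) :
  option (hom (unprime_ob a) (unprime_ob b)) :=
  match p in path _ _ b return option (hom (unprime_ob a) (unprime_ob b)) with
  | ε => Some (idm _)
  | f ∙ q => ocomp (unprime_edge f) (unprime_path q)
  end.

Lemma unprime_path_cat (a b c : S_ob) (q : path S_edge b c) (p : path S_edge a b) :
  unprime_path (pcat q p) = ocomp (unprime_path q) (unprime_path p).
Proof.
elim: q => [|c' d f q IH].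
  by rewrite [pcat _ _]/=; case: (unprime_path p) => //= f; congr Some; symmetry; exact: (@comp1m S _ _ f).
rewrite [LHS]/= IH /=; case: (unprime_edge f) => //= g.
case: (unprime_path q) => //= h; case: (unprime_path p) => //= k.
by congr Some; exact: (@compA S _ _ _ _ g h k).
Qed.

Definition primed (a : S_ob) : Prop :=
  match a with x0 | x1 | x2 | x3 => False | _ => True end.

Lemma primed_path (a b : S_ob) (p : path S_edge a b) : primed a -> primed b.
Proof. by elim: p => // b' c [] //= p IH /IH. Qed.

Lemma unprime_path_eq (a b : S_ob) (p q : path S_edge a b) :
  path_eq S_rel p q -> primed a -> unprime_path p = unprime_path q.
Proof.
elim=> {a b p q} [a b p q r|//|a b p q _ IH /IH //
    |a b p q r _ IH1 _ IH2 pa|a b c q q' p p' _ IH1 _ IH2 pa].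
- case: r => //= _.
  + exact: (f_equal Some (S_relE rel_ds_00)).
  + exact: (f_equal Some (S_relE rel_dd'_0)).
  + exact: (f_equal Some (S_relE rel_d0d1)).
- by rewrite IH1 // IH2.
- by rewrite !unprime_path_cat IH2 // IH1 //; apply: (primed_path p).
Qed.

Fixpoint path_T (a b : IT_ob) (p : path IT_edge a b) :
  path S_edge (ob_T a) (ob_T b) :=
  match p in path _ _ b return path S_edge (ob_T a) (ob_T b) with
  | ε => ε
  | f ∙ q =>
    match f in IT_edge b c
      return path S_edge (ob_T a) (ob_T b) -> path S_edge (ob_T a) (ob_T c) with
    | it_s0_0 => pcons s0'_0
    | it_d0_1 => pcons d0'_1
    | it_d1_1 => pcons d1'_1
    | it_d0_2 => pcons d0'_2
    | it_d1_2 => pcons d1'_2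
    | it_d2_2 => pcons d2'_2
    | it_d0'_1 => pcons d0''_1
    end (path_T q)
  end.

Lemma deval_diagram_T (a b : IT_ob) (p : path IT_edge a b) :
  deval diagram_T p = path_class S_rel (path_T p).
Proof.
elim: p => // b' c f p IH; rewrite [LHS]/= IH.
by case: f p {IH} => p; apply: path_class_compE.
Qed.

Lemma unprime_ob_T (a : IT_ob) : unprime_ob (ob_T a) = ob_I a.
Proof. by case: a. Defined.

Lemma unprime_path_T (a b : IT_ob) (p : path IT_edge a b) :
  unprime_path (path_T p) =
  match eq_sym (unprime_ob_T a) in _ = a', eq_sym (unprime_ob_T b) in _ = b'
    return option (hom a' b') with
  | eq_refl, eq_refl => Some (deval diagram_I p)
  end.
Proof.
by case: a p => p; elim: p => // b' c [] p IH /=; rewrite IH.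
Qed.

Lemma unprime_subproof (a b : IT_ob) (p q : path IT_edge a b) :
  deval diagram_T p = deval diagram_T q -> deval diagram_I p = deval diagram_I q.
Proof.
rewrite !deval_diagram_T => /path_class_eq /unprime_path_eq.
rewrite !unprime_path_T.
by case: a p q => p q; case: b p q => p q /= /(_ I) [].
Qed.

Definition generators_I : diagram IT_edge S_I :=
  Diagram (dob := fun a : IT_ob => a : S_I)
    (fun a b f => generated_arrow diagram_I (f ∙ ε)).

Lemma generators_I_subproof (a b : IT_ob) (p q : path IT_edge a b) :
  deval diagram_T p = deval diagram_T q ->
  deval generators_I p = deval generators_I q.
Proof.
have E c (r : path IT_edge a c) :
    deval generators_I r = generated_arrow diagram_I r.
  elim: r => [|b' c' f r IH]; apply: generated_hom_eq => //.
  rewrite [deval _ _]/= IH.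
  exact: (f_equal (fun h => h ∘ deval diagram_I r) (compm1 (darr diagram_I f))).
by move=> /unprime_subproof e; rewrite !E; apply: generated_hom_eq.
Qed.

(* The isomorphism S_T -> S_I inverse to adding one prime: both subcategories
   have the common shape as objects, so it is the identity on objects, and it
   sends a composite of generators to the composite of the same shape. *)
Definition unprime : functor S_T S_I := generated_functor generators_I_subproof.

Inductive arrow_ob := src | tgt.
Inductive arrow_edge : arrow_ob -> arrow_ob -> Type := arr : arrow_edge src tgt.

Definition arrow_diagram (C : category) (a b : C) (f : hom a b) :
  diagram arrow_edge C :=
  let ob v := match v with src => a | tgt => b end in
  Diagram (dob := ob) (fun v w k =>
    match k in arrow_edge v w return hom (ob v) (ob w) with arr => f end).

Lemma arrow_path_eq (v w : arrow_ob) (p q : path arrow_edge v w) : p = q.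
Proof.
have N u (r : path arrow_edge v u) :
  match v as v, u as u return path arrow_edge v u -> Prop with
  | src, src => fun r => r = ε
  | src, tgt => fun r => r = arr ∙ ε
  | tgt, src => fun _ => False
  | tgt, tgt => fun r => r = ε
  end r.
  elim: r => [|b c [] r]; first by case: v {p q}.
  by case: v {p q} r => //= r ->.
by move: (N w p) (N w q); clear N; case: v p q => p q; case: w p q => p q // -> ->.
Qed.

Definition arrow_category (C : category) (a b : C) (f : hom a b) : category :=
  generated_subcategory (arrow_diagram f).

Definition arrow_functor (C : category) (a b : C) (f : hom a b) (B : category)
  (c d : B) (g : hom c d) : functor (arrow_category f) B :=
  generated_functor (D := arrow_diagram f) (D' := arrow_diagram g)
    (fun v w p q _ => f_equal (@deval _ _ _ (arrow_diagram g) v w) (arrow_path_eq p q)).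

Lemma arrow_nat_trans_subproof (C : category) (a b : C) (f : hom a b)
  (B : category) (c d c' d' : B) (g : hom c d) (g' : hom c' d')
  (u : hom c c') (v : hom d d') (e : v ∘ g = g' ∘ u)
  (i j : arrow_ob) (k : arrow_edge i j) :
  match j return hom (arrow_functor f g j) (arrow_functor f g' j) with
  | src => u | tgt => v end
    ∘ fmap (arrow_functor f g) (generated_arrow (arrow_diagram f) (k ∙ ε)) =
  fmap (arrow_functor f g') (generated_arrow (arrow_diagram f) (k ∙ ε))
    ∘ match i return hom (arrow_functor f g i) (arrow_functor f g' i) with
      | src => u | tgt => v end.
Proof. by case: k; rewrite !generated_functor_arrow /= !compm1. Qed.

Definition arrow_nat_trans (C : category) (a b : C) (f : hom a b)
  (B : category) (c d c' d' : B) (g : hom c d) (g' : hom c' d')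
  (u : hom c c') (v : hom d d') (e : v ∘ g = g' ∘ u) :
  nat_trans (arrow_functor f g) (arrow_functor f g') :=
  generated_nat_trans (arrow_nat_trans_subproof f e).

(* y |-> (s_(y k) : F (y k) -> G (y k)), as a functor on the subcategory
   generated by the single arrow f. *)
Definition component_functor (S : category) (a b : S) (f : hom a b)
  (B : category) (F G : functor B B) (s : nat_trans F G) (k : S) :
  functor ⟦S, B⟧ ⟦arrow_category f, B⟧.
Proof.
refine {| fobj := fun y : ⟦S, B⟧ =>
    arrow_functor f (s ((y : functor S B) k)) : ⟦arrow_category f, B⟧;
  fmap := fun (y z : ⟦S, B⟧) (t : hom y z) =>
    arrow_nat_trans f (eq_sym (naturality s ((t : nat_trans _ _) k))) |}.
- abstract (by move=> y; apply: nat_trans_eq => -[]; rewrite /= fmap1).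
- abstract (by move=> y z w t u; apply: nat_trans_eq => -[]; rewrite /= fmapM).
Defined.

Definition S_m0 : category := arrow_category (gen m_0).
Definition S_m1 : category := arrow_category (gen m_1).
Definition S_e0 : category := arrow_category (gen e_0).
Definition S_e1 : category := arrow_category (gen e_1).

Section Comparison.
Context (B : category).

Definition Target : category :=
  ⟦S_T, B⟧ ⊗ ⟦S_m0, B⟧ ⊗ ⟦S_m1, B⟧ ⊗ ⟦S_e0, B⟧ ⊗ ⟦S_e1, B⟧.

Definition S_star : functor ⟦S, B⟧ Target :=
  ⟨precomposition B (generated_inclusion diagram_T),
  ⟨precomposition B (generated_inclusion (arrow_diagram (gen m_0))),
  ⟨precomposition B (generated_inclusion (arrow_diagram (gen m_1))),
  ⟨precomposition B (generated_inclusion (arrow_diagram (gen e_0))),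
   precomposition B (generated_inclusion (arrow_diagram (gen e_1)))⟩⟩⟩⟩.

Definition Phi (T : monad B) : functor ⟦S, B⟧ Target :=
  ⟨postcomposition S_T T
     ⊚ precomposition B (generated_inclusion diagram_I ⊚ unprime),
  ⟨component_functor (gen m_0) (mmul T) (x0 : S),
  ⟨component_functor (gen m_1) (mmul T) (x1 : S),
  ⟨component_functor (gen e_0) (munit T) (x0 : S),
   component_functor (gen e_1) (munit T) (x1 : S)⟩⟩⟩⟩.
End Comparison.

Section Canonical.
Context {B : category} {T : monad B}.

Definition canonical_ob (x : pre_multicategory T) (a : S_ob) : B :=
  match a with
  | x0 => cob0 x | x1 => cob1 x | x2 => cob2 x | x3 => cob3 x
  | x0' => T (cob0 x) | x1' => T (cob1 x) | x2' => T (cob2 x)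
  | x0'' => T (T (cob0 x)) | x1'' => T (T (cob1 x))
  end.

Definition canonical_diagram (x : pre_multicategory T) : diagram S_edge B :=
  Diagram (dob := canonical_ob x) (fun a b f =>
    match f in S_edge a b return hom (canonical_ob x a) (canonical_ob x b) with
    | s0_0 => cs0_0 x
    | s0_1 => cs0_1 x
    | s1_1 => cs1_1 x
    | d0_1 => cd0_1 x
    | d0_2 => cd0_2 x
    | d1_2 => cd1_2 x
    | d0_3 => cd0_3 x
    | d1_3 => cd1_3 x
    | d2_3 => cd2_3 x
    | d1_1 => cd1_1 x
    | d2_2 => cd2_2 x
    | d3_3 => cd3_3 x
    | e_0 => munit T (cob0 x)
    | e_1 => munit T (cob1 x)
    | s0'_0 => fmap T (cs0_0 x)
    | d0'_1 => fmap T (cd0_1 x)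
    | d0'_2 => fmap T (cd0_2 x)
    | d1'_2 => fmap T (cd1_2 x)
    | d1'_1 => fmap T (cd1_1 x)
    | d2'_2 => fmap T (cd2_2 x)
    | d0''_1 => fmap T (fmap T (cd0_1 x))
    | m_0 => mmul T (cob0 x)
    | m_1 => mmul T (cob1 x)
    end).

Lemma canonical_subproof (x : multicategory T) (a b : S_ob)
  (p q : path S_edge a b) :
  S_rel p q -> deval (canonical_diagram x) p = deval (canonical_diagram x) q.
Proof.
case; rewrite /= ?compm1.
- apply: (pullback_ext (cpb2 x)); rewrite !compA !(pairing1, pairing2).
    by rewrite comp1m -compA cd0_1_cs0_0 compm1.
  by rewrite -compA cd1_1_cs0_0 (naturality (munit T)).
- exact: cd1_1_cs0_0.
- exact: pairing2.
- exact: cd0_1_cs0_0.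
- exact: cd1_2_cs0_1.
- exact: cd1_2_cs1_1.
- exact: pairing1.
- exact: pairing2.
- exact: pairing1.
- by rewrite -fmapM cd0_1_cs0_0 fmap1.
- by rewrite cd1_1_cd1_2 compA.
- by rewrite pairing2 compA.
- exact: (proj1 (cpb2 x)).
- exact: (proj1 (cpb3 x)).
- by rewrite pairing2.
- exact: cd0_1_cd1_2.
- exact: pairing1.
- exact: pairing1.
- by rewrite cd1_2_cd1_3.
- by rewrite -!fmapM (proj1 (cpb2 x)).
- by rewrite -!fmapM cd0_1_cd1_2.
Qed.

Definition canonical_model (x : multicategory T) : functor S B :=
  presented_functor (@canonical_subproof x).

Lemma canonical_model_gen (x : multicategory T) (a b : S_ob) (f : S_edge a b) :
  fmap (canonical_model x) (gen f) = darr (canonical_diagram x) f.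
Proof. exact: presented_functor_generator. Qed.

Lemma canonical_is_model (cT : cartesian_monad T) (x : multicategory T) :
  is_model (canonical_model x).
Proof.
split; [|split]; rewrite !canonical_model_gen /=.
- exact: cpb2.
- exact: cpb3.
- exact: (proj1 cT _ _ _ _ _ _ _ _ (cpb2 x)).
Qed.

Definition canonical_component (x y : multicategory T) (p : multifunctor x y)
  (a : S_ob) : hom (canonical_ob x a) (canonical_ob y a) :=
  match a with
  | x0 => mf0 p | x1 => mf1 p | x2 => mf2 p | x3 => mf3 p
  | x0' => fmap T (mf0 p) | x1' => fmap T (mf1 p) | x2' => fmap T (mf2 p)
  | x0'' => fmap T (fmap T (mf0 p)) | x1'' => fmap T (fmap T (mf1 p))
  end.

Lemma canonical_natural (x y : multicategory T) (p : multifunctor x y)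
  (a b : S_ob) (f : S_edge a b) :
  canonical_component p b ∘ fmap (canonical_model x) (gen f) =
  fmap (canonical_model y) (gen f) ∘ canonical_component p a.
Proof.
rewrite !canonical_model_gen; symmetry; case: f => /=.
- by rewrite mf_s0_0.
- apply: (pullback_ext (cpb2 y)); rewrite !compA !(pairing1, pairing2).
    by rewrite -compA pairing1 comp1m compm1.
  by rewrite -!compA pairing2 mf_d1_1 !compA -!fmapM mf_s0_0.
- apply: (pullback_ext (cpb2 y)); rewrite !compA !(pairing1, pairing2).
    by rewrite -!compA pairing1 mf_d0_1 !compA mf_s0_0.
  by rewrite -!compA pairing2 (naturality (munit T)).
- by rewrite mf_d0_1.
- exact: pairing1.
- by rewrite mf_d1_2.
- exact: pairing1.
- apply: (pullback_ext (cpb2 y)); rewrite !compA !(pairing1, pairing2).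
    rewrite -!compA (pairing1 (cpb3 y)) (pairing1 (cpb2 x)) !compA.
    by rewrite (pairing1 (cpb2 y)).
  rewrite -!compA (pairing2 (cpb3 y)) (pairing2 (cpb2 x)) !compA -!fmapM.
  by rewrite mf_d1_2.
- apply: (pullback_ext (cpb2 y)); rewrite !compA !(pairing1, pairing2).
    rewrite -!compA (pairing1 (cpb3 y)) (pairing1 (cpb2 x)) !compA.
    by rewrite mf_d1_2.
  rewrite -!compA (pairing2 (cpb3 y)) (pairing2 (cpb2 x)) !compA.
  rewrite -(naturality (mmul T)) -!(compA (mmul T _)) /= -!fmapM.
  by rewrite (pairing2 (cpb2 y)).
- by rewrite mf_d1_1.
- exact: pairing2.
- exact: pairing2.
- by rewrite (naturality (munit T)).
- by rewrite (naturality (munit T)).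
- by rewrite -!fmapM mf_s0_0.
- by rewrite -!fmapM mf_d0_1.
- by rewrite -!fmapM pairing1.
- by rewrite -!fmapM mf_d1_2.
- by rewrite -!fmapM mf_d1_1.
- by rewrite -!fmapM pairing2.
- by rewrite -!fmapM mf_d0_1.
- by rewrite (naturality (mmul T)).
- by rewrite (naturality (mmul T)).
Qed.

Definition canonical_morphism (x y : multicategory T) (p : multifunctor x y) :
  nat_trans (canonical_model x) (canonical_model y) :=
  @presented_nat_trans _ _ S_rel B (canonical_model x) (canonical_model y)
    (canonical_component p) (canonical_natural p).

Definition canonical (cT : cartesian_monad T) : functor (Cat T) (Mod B).
Proof.
unshelve refine {| fobj := fun x : Cat T =>
    exist _ (canonical_model x) (canonical_is_model cT x) : Mod B;
  fmap := fun (x y : Cat T) (p : hom x y) => canonical_morphism p |}.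
- abstract (by move=> x; apply: nat_trans_eq => -[] /=;
    rewrite ?mf2_id ?mf3_id ?fmap1).
- abstract (by move=> x y z q p; apply: nat_trans_eq => -[] /=;
    rewrite ?mf2_comp ?mf3_comp ?fmapM).
Defined.
End Canonical.

(* Main.v *)
(* Pullbacks of models are computed pointwise, because limits commute with
   limits, so restriction along S_T, S_(m_i), S_(e_i) preserves them, and so does
   Phi because T does.  A model on which S_star and Phi agree has all its primed
   values and all its m_i, e_i prescribed by the unprimed part and T; its
   degeneracies s_0, s_1 : x_1 -> x_2 and faces d_1, d_2 : x_3 -> x_2 are forced
   by the relations and the pullback x_2.  Hence it is the canonical model of a
   unique multicategory, and likewise for morphisms.
   The canonical functor being bijective onto this strictly defined part of Mod,
   a pullback in Cat is obtained from a pointwise pullback of canonical models in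
   which the cones at the primed objects are chosen to be the T-images of those
   at the unprimed ones: strictness then follows from uniqueness of pairings. *)
From Corelib Require Import ssreflect.
From Stdlib Require Import FunctionalExtensionality ProofIrrelevance
  ClassicalEpsilon.
Require Import Defs.
Local Open Scope cat_scope.

Set Implicit Arguments.
Unset Strict Implicit.
Unset Printing Implicit Defensive.

(** * Heterogeneous equality of arrows *)

(** Strict equality of functors compares arrows whose endpoints are equal only propositionally; this
    relation states such comparisons without explicit transports. *)
Inductive heq (C : category) (a b : C) (f : hom a b) :
  forall c d : C, hom c d -> Prop := heq_refl : heq f f.

Section Heq.
Context {C : category}.

(** Packing an arrow with its endpoints turns [heq] into equality of dependent pairs, whose second
    components are equal by [inj_pairT2], hence by proof irrelevance. *)
Lemma heq_eq (a b : C) (f g : hom a b) : heq f g -> f = g.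
Proof.
pose pack (c d : C) (h : hom c d) :=
  existT (fun p : C * C => hom (fst p) (snd p)) (c, d) h.
have packE c d (h : hom c d) : heq f h -> pack a b f = pack c d h by case.
by move=> /packE e; exact: (inj_pairT2 _ _ _ _ _ e).
Qed.

Lemma eq_heq (a b : C) (f g : hom a b) : f = g -> heq f g.
Proof. by move=> ->; apply: heq_refl. Qed.

Lemma heq_source (a b c d : C) (f : hom a b) (g : hom c d) : heq f g -> a = c.
Proof. by case. Qed.

Lemma heq_target (a b c d : C) (f : hom a b) (g : hom c d) : heq f g -> b = d.
Proof. by case. Qed.

Lemma heq_sym (a b c d : C) (f : hom a b) (g : hom c d) : heq f g -> heq g f.
Proof. by case. Qed.

Lemma heq_trans (a b c d a' b' : C) (f : hom a b) (g : hom c d) (h : hom a' b') :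
  heq f g -> heq g h -> heq f h.
Proof. by move=> fg; case. Qed.

Lemma heq_comp (a b c a' b' c' : C) (g : hom b c) (f : hom a b)
  (g' : hom b' c') (f' : hom a' b') :
  heq g g' -> heq f f' -> heq (g ∘ f) (g' ∘ f').
Proof.
move=> gg ff; have ea := heq_source ff; have eb := heq_target ff.
have ec := heq_target gg; subst a' b' c'.
by rewrite (heq_eq gg) (heq_eq ff); apply: heq_refl.
Qed.

Lemma heq_idm (a b : C) : a = b -> heq (idm a) (idm b).
Proof. by move=> ->; apply: heq_refl. Qed.

Lemma heq_fmap (D : category) (F : functor C D) (a b c d : C) (f : hom a b)
  (g : hom c d) : heq f g -> heq (fmap F f) (fmap F g).
Proof. by case; apply: heq_refl. Qed.

Lemma heq_functor (D : category) (F G : functor C D) (a b : C) (f : hom a b) :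
  F = G -> heq (fmap F f) (fmap G f).
Proof. by move=> ->; apply: heq_refl. Qed.
End Heq.

(** * Extensionality of functors and natural transformations up to [heq] *)

Lemma functor_eq (C D : category) (F G : functor C D) :
  (forall a, F a = G a) ->
  (forall (a b : C) (f : hom a b), heq (fmap F f) (fmap G f)) -> F = G.
Proof.
case: F G => [Fo Fm F1 FM] [Go Gm G1 GM] /= eo em.
have e : Fo = Go by apply: functional_extensionality.
subst Go; have e : Fm = Gm.
  do 3!(apply: functional_extensionality_dep => ?); exact: heq_eq.
by subst Gm; f_equal; apply: proof_irrelevance.
Qed.

Lemma heq_nat_trans (C D : category) (F G F' G' : functor C D)
  (s : nat_trans F G) (t : nat_trans F' G') :
  F = F' -> G = G' -> (forall a, heq (s a) (t a)) ->
  @heq ⟦C, D⟧ F G s F' G' t.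
Proof.
move=> eF eG; subst F' G' => st.
by rewrite (nat_trans_eq (fun a => heq_eq (st a))); apply: heq_refl.
Qed.

Lemma heq_component (C D : category) (F G F' G' : ⟦C, D⟧) (s : hom F G)
  (t : hom F' G') :
  heq s t -> forall a, heq ((s : nat_trans _ _) a) ((t : nat_trans _ _) a).
Proof. by case=> a; apply: heq_refl. Qed.

Lemma heq_pair (C D : category) (a b c d : C) (f : hom a b) (g : hom c d)
  (a' b' c' d' : D) (f' : hom a' b') (g' : hom c' d') :
  heq f g -> heq f' g' ->
  @heq (C ⊗ D) (a, a') (b, b') (f, f') (c, c') (d, d') (g, g').
Proof. by case; case; apply: heq_refl. Qed.

Lemma heq_pair_inv (C D : category) (a b c d : C ⊗ D) (f : hom a b)
  (g : hom c d) : heq f g -> heq (fst f) (fst g) /\ heq (snd f) (snd g).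
Proof. by case; split; apply: heq_refl. Qed.

(** Every arrow is the class of a path, so induction on the path reduces agreement to generators.
    The same argument serves generated subcategories below. *)
Lemma presented_functor_ext (V : Type) (E : V -> V -> Type)
  (R : forall a b, path E a b -> path E a b -> Prop) (C : category)
  (F G : functor (presented_category R) C) :
  (forall a : V, F a = G a) ->
  (forall (a b : V) (f : E a b),
    heq (fmap F (generator R f)) (fmap G (generator R f))) -> F = G.
Proof.
move=> eo em; apply: functor_eq => // a b f.
case: (path_classP f) => p ->; rewrite -deval_generator.
elim: p => [|c d g p IH] /=.
  by rewrite (fmap1 F) (fmap1 G); apply: heq_idm.
by rewrite (fmapM F) (fmapM G); apply: heq_comp.
Qed.

Lemma generated_functor_ext (V : Type) (E : V -> V -> Type) (C : category)
  (D : diagram E C) (B : category) (F G : functor (generated_subcategory D) B) :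
  (forall a : V, F a = G a) ->
  (forall (a b : V) (f : E a b),
    heq (fmap F (generated_arrow D (f ∙ ε))) (fmap G (generated_arrow D (f ∙ ε)))) ->
  F = G.
Proof.
move=> eo em; apply: functor_eq => // a b f; rewrite -(generated_pathK f).
elim: (generated_path f) => [|c d g p IH].
  have -> : generated_arrow D ε = @idm (generated_subcategory D) a.
    exact: generated_hom_eq.
  by rewrite (fmap1 F) (fmap1 G); apply: heq_idm.
have -> : generated_arrow D (g ∙ p) = @comp (generated_subcategory D) _ _ _
    (generated_arrow D (g ∙ ε)) (generated_arrow D p).
  by apply: generated_hom_eq; rewrite /= compm1.
by rewrite (fmapM F) (fmapM G); apply: heq_comp.
Qed.

(** * A criterion for strict equalizers *)

(** The lifting hypotheses give the values of a factorization, selected by choice; faithfulness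
    makes them functorial, and together with injectivity on objects makes the factorization
    unique. *)
Lemma is_equalizer_intro (E C D : category) (K : functor E C) (F G : functor C D) :
  F ⊚ K = G ⊚ K ->
  (forall x y : E, K x = K y -> x = y) ->
  (forall (x y : E) (f g : hom x y), fmap K f = fmap K g -> f = g) ->
  (forall c : C, F c = G c -> exists x, K x = c) ->
  (forall (x y : E) (f : hom (K x) (K y)),
    heq (fmap F f) (fmap G f) -> exists g, fmap K g = f) ->
  is_equalizer K F G.
Proof.
move=> FGK inj faithful lift_ob lift_hom; split=> // A H FGH.
have obP a : {x | K x = H a}.
  apply: constructive_indefinite_description; apply: lift_ob.
  exact: (f_equal (fun M : functor A D => M a) FGH).
pose x a := proj1_sig (obP a).
have xE a : K (x a) = H a := proj2_sig (obP a).
have homP a b (f : hom a b) : {g : hom (x a) (x b) | heq (fmap K g) (fmap H f)}.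
  apply: constructive_indefinite_description.
  have := heq_functor f FGH => /=.
  (* Generalizing the arrow lets its endpoints be rewritten into the image of [K], where [lift_hom]
     applies. *)
  move: (fmap H f); rewrite -(xE a) -(xE b) => h /lift_hom [g <-].
  by exists g; apply: heq_refl.
pose l a b (f : hom a b) := proj1_sig (homP a b f).
have lE a b f : heq (fmap K (l a b f)) (fmap H f) := proj2_sig (homP a b f).
have l1 a : l a a (idm a) = idm (x a).
  apply: faithful; apply: heq_eq; apply: heq_trans (lE _ _ _) _.
  by rewrite !fmap1; apply: heq_idm.
have lM a b c (g : hom b c) (f : hom a b) :
    l a c (g ∘ f) = l b c g ∘ l a b f.
  apply: faithful; apply: heq_eq; apply: heq_trans (lE _ _ _) _.
  by rewrite !fmapM; apply: heq_sym; apply: heq_comp.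
pose L : functor A E := Functor l1 lM.
have KL : K ⊚ L = H by apply: functor_eq.
exists L; split=> // L' KL'; have e : K ⊚ L = K ⊚ L' by rewrite KL.
have eo a : L a = L' a by apply: inj; exact: (f_equal (fun M : functor A C => M a) e).
apply: functor_eq => // a b f.
have := heq_functor f e => /=.
move: (fmap L f) (fmap L' f); rewrite -(eo a) -(eo b) => g g' h.
by rewrite (faithful _ _ _ _ (heq_eq h)); apply: heq_refl.
Qed.

(** * Uniqueness of pullbacks up to isomorphism *)

Section Pullbacks.
Context {B : category}.

Lemma pullback_unique (p q a b c : B) (p1 : hom p a) (p2 : hom p b)
  (q1 : hom q a) (q2 : hom q b) (f : hom a c) (g : hom b c) :
  is_pullback p1 p2 f g -> is_pullback q1 q2 f g ->
  exists (i : hom q p) (j : hom p q),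
    i ∘ j = idm p /\ j ∘ i = idm q /\ p1 ∘ i = q1 /\ p2 ∘ i = q2.
Proof.
move=> pb pb'; exists (pairing pb (proj1 pb')), (pairing pb' (proj1 pb)).
by do !split; rewrite ?pairing1 ?pairing2 //;
  [apply: (pullback_ext pb)|apply: (pullback_ext pb')];
  rewrite compA !(pairing1, pairing2) compm1.
Qed.

Lemma pullback_iso (p q a b c : B) (p1 : hom p a) (p2 : hom p b) (f : hom a c)
  (g : hom b c) (i : hom q p) (j : hom p q) :
  i ∘ j = idm p -> j ∘ i = idm q ->
  is_pullback p1 p2 f g -> is_pullback (p1 ∘ i) (p2 ∘ i) f g.
Proof.
move=> ij ji pb; split=> [|z u v e]; first by rewrite !compA (proj1 pb).
exists (j ∘ pairing pb e); split=> [|w [e1 e2]].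
  by rewrite -!compA !(compA i) ij comp1m pairing1 pairing2.
have -> : pairing pb e = i ∘ w.
  by apply: (pullback_ext pb); rewrite ?pairing1 ?pairing2 compA.
by rewrite compA ji comp1m.
Qed.
End Pullbacks.

(** One preserved pullback for each cospan suffices: any other pullback of it is isomorphic to that
    one, and functors preserve isomorphisms. *)
Lemma preserves_pullbacks_intro (C D : category) (F : functor C D) :
  (forall (a b c : C) (f : hom a c) (g : hom b c),
    exists (p : C) (p1 : hom p a) (p2 : hom p b), is_pullback p1 p2 f g /\
      is_pullback (fmap F p1) (fmap F p2) (fmap F f) (fmap F g)) ->
  preserves_pullbacks F.
Proof.
move=> ex q a b c q1 q2 f g pbq.
have [p [p1 [p2 [pb pbF]]]] := ex a b c f g.
have [i [j [ij [ji [<- <-]]]]] := pullback_unique pb pbq.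
rewrite !fmapM; apply: (pullback_iso (j := fmap F j)) pbF.
  by rewrite -fmapM ij fmap1.
by rewrite -fmapM ji fmap1.
Qed.

Lemma product_pullback (C D : category) (p a b c : C ⊗ D) (p1 : hom p a)
  (p2 : hom p b) (f : hom a c) (g : hom b c) :
  is_pullback (fst p1) (fst p2) (fst f) (fst g) ->
  is_pullback (snd p1) (snd p2) (snd f) (snd g) -> is_pullback p1 p2 f g.
Proof.
move=> pb pb'; split.
  by rewrite /comp /= (proj1 pb) (proj1 pb').
move=> z u v e; have e1 := f_equal fst e; have e2 := f_equal snd e.
exists (pairing pb e1, pairing pb' e2); split.
  split; rewrite /comp /= ?pairing1 ?pairing2; [by case: u {e e1 e2}|by case: v {e e1 e2}].
case=> w w' [ew ew']; congr pair;
  [apply: (pullback_ext pb)|apply: (pullback_ext pb')]; rewrite !(pairing1, pairing2);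
  by rewrite -?ew -?ew'.
Qed.

(** * Pointwise pullbacks in functor categories *)

Section PointwisePullbacks.
Context {C B : category}.

Lemma nat_trans_pullback (P X Y Z : functor C B) (p1 : nat_trans P X)
  (p2 : nat_trans P Y) (f : nat_trans X Z) (g : nat_trans Y Z) :
  (forall a, is_pullback (p1 a) (p2 a) (f a) (g a)) ->
  @is_pullback ⟦C, B⟧ P X Y Z p1 p2 f g.
Proof.
move=> pb; split; first by apply: nat_trans_eq => a; exact: (proj1 (pb a)).
move=> W u v e.
have ea a : f a ∘ (u : nat_trans _ _) a = g a ∘ (v : nat_trans _ _) a.
  exact: (f_equal (fun t : nat_trans W Z => t a) e).
unshelve eexists.
  refine {| component := fun a => pairing (pb a) (ea a) |} => a b h.
  apply: (pullback_ext (pb b)); rewrite !compA.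
    rewrite pairing1 (naturality p1) -compA pairing1; exact: naturality.
  rewrite pairing2 (naturality p2) -compA pairing2; exact: naturality.
split; first by split; apply: nat_trans_eq => a; rewrite /= (pairing1, pairing2).
move=> w [ew1 ew2]; apply: nat_trans_eq => a.
by apply: (pullback_ext (pb a)); rewrite /= (pairing1, pairing2) -?ew1 -?ew2.
Qed.

(** A cone over the square in [P] projects to cones over the squares in [X] and [Y]. The two induced
    arrows agree in [Z a] by uniqueness there, so they pair into [P a]. *)
Lemma limits_commute (P X Y Z : functor C B) (p1 : nat_trans P X)
  (p2 : nat_trans P Y) (f : nat_trans X Z) (g : nat_trans Y Z)
  (pb : forall a, is_pullback (p1 a) (p2 a) (f a) (g a))
  (a b c d : C) (h : hom a b) (h' : hom a c) (k : hom b d) (k' : hom c d) :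
  is_pullback (fmap X h) (fmap X h') (fmap X k) (fmap X k') ->
  is_pullback (fmap Y h) (fmap Y h') (fmap Y k) (fmap Y k') ->
  is_pullback (fmap Z h) (fmap Z h') (fmap Z k) (fmap Z k') ->
  is_pullback (fmap P h) (fmap P h') (fmap P k) (fmap P k').
Proof.
move=> pX pY pZ; split.
  apply: (pullback_ext (pb d)); rewrite !compA !naturality -!compA !naturality
    !compA; by rewrite ?(proj1 pX) ?(proj1 pY).
move=> z u v e.
have eX : fmap X k ∘ (p1 b ∘ u) = fmap X k' ∘ (p1 c ∘ v).
  by rewrite !compA -!naturality -!compA e.
have eY : fmap Y k ∘ (p2 b ∘ u) = fmap Y k' ∘ (p2 c ∘ v).
  by rewrite !compA -!naturality -!compA e.
have ea : f a ∘ pairing pX eX = g a ∘ pairing pY eY.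
  by apply: (pullback_ext pZ); rewrite !compA -!naturality -!compA
    !(pairing1, pairing2) !compA (proj1 (pb _)).
exists (pairing (pb a) ea); split.
  by split; [apply: (pullback_ext (pb b))|apply: (pullback_ext (pb c))];
    rewrite !compA naturality -compA !(pairing1, pairing2).
move=> w [ew ew'].
by apply: (pullback_ext (pb a)); rewrite !(pairing1, pairing2);
  [apply: (pullback_ext pX)|apply: (pullback_ext pY)];
  rewrite !(pairing1, pairing2) -?ew -?ew' !compA naturality.
Qed.

Context {X Y Z : functor C B} (f : nat_trans X Z) (g : nat_trans Y Z).
Context (P : C -> B) (p1 : forall a, hom (P a) (X a)) (p2 : forall a, hom (P a) (Y a)).
Context (pb : forall a, is_pullback (p1 a) (p2 a) (f a) (g a)).

Lemma pointwise_map_subproof (a b : C) (h : hom a b) :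
  f b ∘ (fmap X h ∘ p1 a) = g b ∘ (fmap Y h ∘ p2 a).
Proof. by rewrite !compA !naturality -!compA (proj1 (pb a)). Qed.

Definition pointwise_map (a b : C) (h : hom a b) : hom (P a) (P b) :=
  pairing (pb b) (pointwise_map_subproof h).

(** The cone at each object is a parameter, so that later the cones at primed objects can be taken
    to be images under [T]; only the action on arrows is constructed. *)
Definition pointwise_pullback : functor C B.
Proof.
refine {| fobj := P; fmap := pointwise_map |}.
- abstract (by move=> a; apply: (pullback_ext (pb a));
    rewrite (pairing1, pairing2) fmap1 comp1m compm1).
- abstract (by move=> a b c k h; apply: (pullback_ext (pb c));
    rewrite compA !(pairing1, pairing2) -compA !(pairing1, pairing2) fmapM compA).
Defined.

Definition pointwise_fst : nat_trans pointwise_pullback X :=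
  NatTrans (F := pointwise_pullback) (component := p1) (fun a b h => pairing1 _ _).

Definition pointwise_snd : nat_trans pointwise_pullback Y :=
  NatTrans (F := pointwise_pullback) (component := p2) (fun a b h => pairing2 _ _).
End PointwisePullbacks.

(** * Pullbacks of models and their preservation by [S_star] and [Phi] *)

Section Models.
Context {B : category}.

Section PointwiseModels.
Context {P X Y Z : functor S B} (p1 : nat_trans P X) (p2 : nat_trans P Y).
Context (f : nat_trans X Z) (g : nat_trans Y Z).
Context (pb : forall a, is_pullback (p1 a) (p2 a) (f a) (g a)).

Lemma pointwise_is_model : is_model X -> is_model Y -> is_model Z -> is_model P.
Proof.
by move=> [X1 [X2 X3]] [Y1 [Y2 Y3]] [Z1 [Z2 Z3]]; split; [|split];
  apply: (limits_commute pb).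
Qed.

Lemma S_star_pullback :
  is_pullback (fmap (S_star B) (p1 : @hom ⟦S, B⟧ P X))
    (fmap (S_star B) (p2 : @hom ⟦S, B⟧ P Y))
    (fmap (S_star B) (f : @hom ⟦S, B⟧ X Z))
    (fmap (S_star B) (g : @hom ⟦S, B⟧ Y Z)).
Proof.
by do !apply: product_pullback; apply: nat_trans_pullback => a; apply: pb.
Qed.

Lemma component_functor_pullback (a b : S) (h : hom a b) (F G : functor B B)
  (s : nat_trans F G) (k : S) :
  preserves_pullbacks F -> preserves_pullbacks G ->
  is_pullback (fmap (component_functor h s k) (p1 : @hom ⟦S, B⟧ P X))
    (fmap (component_functor h s k) (p2 : @hom ⟦S, B⟧ P Y))
    (fmap (component_functor h s k) (f : @hom ⟦S, B⟧ X Z))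
    (fmap (component_functor h s k) (g : @hom ⟦S, B⟧ Y Z)).
Proof.
move=> pF pG; apply: nat_trans_pullback => -[]; [exact: pF (pb k)|exact: pG (pb k)].
Qed.

Lemma Phi_pullback (T : monad B) : preserves_pullbacks T ->
  is_pullback (fmap (Phi T) (p1 : @hom ⟦S, B⟧ P X))
    (fmap (Phi T) (p2 : @hom ⟦S, B⟧ P Y))
    (fmap (Phi T) (f : @hom ⟦S, B⟧ X Z))
    (fmap (Phi T) (g : @hom ⟦S, B⟧ Y Z)).
Proof.
move=> pT; have pTT : preserves_pullbacks (T ⊚ T).
  by move=> *; apply: (pT); apply: pT.
have p1B : preserves_pullbacks (functor_id B) by [].
do !apply: product_pullback; try exact: component_functor_pullback.
by apply: nat_trans_pullback => a; apply: pT; apply: pb.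
Qed.
End PointwiseModels.

(** [Mod] is a full subcategory, so the universal property among all functors restricts to
    models. *)
Lemma Mod_pullback (P X Y Z : Mod B) (p1 : hom P X) (p2 : hom P Y) (f : hom X Z)
  (g : hom Y Z) :
  @is_pullback ⟦S, B⟧ (Mod_inclusion B P) (Mod_inclusion B X) (Mod_inclusion B Y)
    (Mod_inclusion B Z) p1 p2 f g ->
  is_pullback p1 p2 f g.
Proof. by case=> e u; split=> // W; apply: (u (Mod_inclusion B W)). Qed.

Lemma Mod_pointwise_pullback (hB : has_pullbacks B) (X Y Z : Mod B) (f : hom X Z)
  (g : hom Y Z) :
  exists (P : Mod B) (p1 : hom P X) (p2 : hom P Y),
    is_pullback p1 p2 f g /\
    forall a : S, is_pullback ((p1 : nat_trans _ _) a) ((p2 : nat_trans _ _) a)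
      ((f : nat_trans _ _) a) ((g : nat_trans _ _) a).
Proof.
case: X Y Z f g => [X mX] [Y mY] [Z mZ] f g.
pose f' : nat_trans (X : functor S B) (Z : functor S B) := f.
pose g' : nat_trans (Y : functor S B) (Z : functor S B) := g.
(* [has_pullbacks] only asserts existence; choice turns it into a family of cones. *)
have coneP a : {p : B & {p1 : hom p _ & {p2 : hom p _ |
    is_pullback p1 p2 (f' a) (g' a)}}}.
  have [p ex1] := constructive_indefinite_description _ (hB _ _ _ (f' a) (g' a)).
  have [p1 ex2] := constructive_indefinite_description _ ex1.
  have [p2 pb] := constructive_indefinite_description _ ex2.
  by exists p, p1, p2.
have pb a := proj2_sig (projT2 (projT2 (coneP a))).
have mP : is_model (pointwise_pullback pb).
  exact: (pointwise_is_model (p1 := pointwise_fst pb) (p2 := pointwise_snd pb) pb).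
exists (exist _ (pointwise_pullback pb : ⟦S, B⟧) mP), (pointwise_fst pb), (pointwise_snd pb).
split; last exact: pb.
by apply: Mod_pullback; apply: nat_trans_pullback.
Qed.

(** A functor commutes with evaluation of paths. This supplies the relations from which a
    multicategory is rebuilt below. *)
Lemma model_relation (y : functor S B) (a b : S_ob) (p q : path S_edge a b) :
  S_rel p q ->
  deval (Diagram (dob := y) (fun c d h => fmap y (gen h))) p =
  deval (Diagram (dob := y) (fun c d h => fmap y (gen h))) q.
Proof.
have E c d (r : path S_edge c d) :
    deval (Diagram (dob := y) (fun c d h => fmap y (gen h))) r =
    fmap y (deval gen_diagram r).
  elim: r => [|v w h r IH]; first by rewrite /= (fmap1 y).
  by rewrite [LHS]/= IH -(fmapM y).
by move=> r; rewrite !E (S_relE r).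
Qed.
End Models.

(** * Strict models: the equalizing condition on generators *)

Section Strict.
Context {B : category} {T : monad B}.

(* These heterogeneous equalities contain equalities of the endpoints, such as
   y x0' = T (y x0). *)
Record strict (y : functor S B) : Prop := Strict {
  strict_T : forall (a b : IT_ob) (f : IT_edge a b),
    heq (fmap y (darr diagram_T f)) (fmap T (fmap y (darr diagram_I f)));
  strict_m0 : heq (fmap y (gen m_0)) (mmul T (y x0));
  strict_m1 : heq (fmap y (gen m_1)) (mmul T (y x1));
  strict_e0 : heq (fmap y (gen e_0)) (munit T (y x0));
  strict_e1 : heq (fmap y (gen e_1)) (munit T (y x1)) }.

(** This is agreement in the [S_T] component of the target; agreement at the [m_i] and [e_i] is
    derived from it in [strict_nat_eq]. *)
Definition strict_nat (y z : functor S B) (t : nat_trans y z) : Prop :=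
  forall a : IT_ob, heq (t (ob_T a)) (fmap T (t (ob_I a))).

(** Each vertex of the shape is an endpoint of some edge, and [heq] of arrows identifies
    endpoints. *)
Lemma strict_ob (y : functor S B) (a : IT_ob) :
  strict y -> y (ob_T a) = T (y (ob_I a)).
Proof.
move=> sy; case: a.
- exact: heq_source (strict_T sy it_s0_0).
- exact: heq_source (strict_T sy it_d0_1).
- exact: heq_source (strict_T sy it_d0_2).
- exact: heq_target (strict_T sy it_d1_1).
- exact: heq_target (strict_T sy it_d2_2).
Qed.

Lemma unprime_generator (a b : IT_ob) (f : IT_edge a b) :
  fmap unprime (generated_arrow diagram_T (f ∙ ε)) =
  generated_arrow diagram_I (f ∙ ε).
Proof. by rewrite generated_functor_arrow; apply: (@compm1 S_I). Qed.

Lemma generated_arrow1 (V : Type) (E : V -> V -> Type) (C : category)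
  (D : diagram E C) (a b : V) (f : E a b) :
  proj1_sig (generated_arrow D (f ∙ ε)) = darr D f.
Proof. exact: compm1. Qed.

Lemma arrow_functor_arr (C : category) (a b : C) (f : hom a b) (c d : B)
  (g : hom c d) :
  fmap (arrow_functor f g) (generated_arrow (arrow_diagram f) (arr ∙ ε)) = g.
Proof. by rewrite generated_functor_arrow; apply: compm1. Qed.

Lemma restriction_arr (C : category) (a b : C) (f : hom a b) (y : functor C B) :
  fmap (y ⊚ generated_inclusion (arrow_diagram f))
    (generated_arrow (arrow_diagram f) (arr ∙ ε)) = fmap y f.
Proof. by rewrite [LHS]/= compm1. Qed.

Lemma restriction_arrow_eq (C : category) (a b : C) (f : hom a b)
  (y : functor C B) (c d : B) (g : hom c d) :
  y ⊚ generated_inclusion (arrow_diagram f) = arrow_functor f g <->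
  heq (fmap y f) g.
Proof.
split=> [e|e].
  have := heq_functor
    (generated_arrow (arrow_diagram f) (arr ∙ ε) : hom (src : arrow_category f) tgt) e.
  by rewrite restriction_arr arrow_functor_arr.
apply: generated_functor_ext => [[]|_ _ []].
- exact: heq_source e.
- exact: heq_target e.
- by rewrite (restriction_arr f y) (arrow_functor_arr f g).
Qed.

Lemma restriction_T_eq (y : functor S B) :
  y ⊚ generated_inclusion diagram_T =
    T ⊚ (y ⊚ (generated_inclusion diagram_I ⊚ unprime)) <->
  (forall (a b : IT_ob) (f : IT_edge a b),
    heq (fmap y (darr diagram_T f)) (fmap T (fmap y (darr diagram_I f)))).
Proof.
have E a b (f : IT_edge a b) :
    fmap (T ⊚ (y ⊚ (generated_inclusion diagram_I ⊚ unprime)))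
      (generated_arrow diagram_T (f ∙ ε)) = fmap T (fmap y (darr diagram_I f)).
  rewrite -(generated_arrow1 diagram_I f) -unprime_generator; reflexivity.
have E' a b (f : IT_edge a b) :
    fmap (y ⊚ generated_inclusion diagram_T)
      (generated_arrow diagram_T (f ∙ ε)) = fmap y (darr diagram_T f).
  by rewrite -(generated_arrow1 diagram_T f).
split=> e.
  move=> a b f; have := heq_functor
    (generated_arrow diagram_T (f ∙ ε) : hom (a : S_T) b) e.
  by rewrite E E'.
apply: generated_functor_ext => [a|a b f]; last by rewrite E E'; exact: e.
case: a => /=.
- exact: heq_source (e _ _ it_s0_0).
- exact: heq_source (e _ _ it_d0_1).
- exact: heq_source (e _ _ it_d0_2).
- exact: heq_target (e _ _ it_d1_1).
- exact: heq_target (e _ _ it_d2_2).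
Qed.

Lemma strict_eq (y : functor S B) :
  S_star B (y : ⟦S, B⟧) = Phi T (y : ⟦S, B⟧) <-> strict y.
Proof.
split=> [e|[sT sm0 sm1 se0 se1]]; first split.
- exact: (proj1 (restriction_T_eq y) (f_equal fst e)).
- exact: (proj1 (restriction_arrow_eq _ _ _) (f_equal (fun t => fst (snd t)) e)).
- exact: (proj1 (restriction_arrow_eq _ _ _)
    (f_equal (fun t => fst (snd (snd t))) e)).
- exact: (proj1 (restriction_arrow_eq _ _ _)
    (f_equal (fun t => fst (snd (snd (snd t)))) e)).
- exact: (proj1 (restriction_arrow_eq _ _ _)
    (f_equal (fun t => snd (snd (snd (snd t)))) e)).
- congr pair; first exact: (proj2 (restriction_T_eq y)).
  by do !congr pair; apply: (proj2 (restriction_arrow_eq _ _ _)).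
Qed.

(** At [m_i] one compares [t] at [x_i''] and [x_i'] with [TT] and [T] of its value at [x_i]; at
    [e_i], [t] at [x_i] and [x_i'] with that value and its [T]-image. All follow from
    [strict_nat]. *)
Lemma strict_nat_eq (y z : functor S B) (t : nat_trans y z) :
  strict y -> strict z ->
  heq (fmap (S_star B) (t : @hom ⟦S, B⟧ y z)) (fmap (Phi T) (t : @hom ⟦S, B⟧ y z))
    <-> strict_nat t.
Proof.
move=> sy sz; split=> [e a|st].
  exact: (heq_component (proj1 (heq_pair_inv e)) a).
(* Strictness used twice: [x_i'] is both the primed copy of [x_i] and an object of [S_I] whose
   primed copy is [x_i'']. *)
have st2 (a : IT_ob) (b : IT_ob) : ob_T a = ob_I b ->
    heq (t (ob_T b)) (fmap T (fmap T (t (ob_I a)))).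
  move=> eab; apply: heq_trans (st b) _; rewrite -eab; exact: heq_fmap (st a).
have ey := proj2 (strict_eq y) sy; have ez := proj2 (strict_eq z) sz.
apply: heq_pair.
  by apply: heq_nat_trans => //; [apply: (f_equal fst ey)|apply: (f_equal fst ez)].
apply: heq_pair.
  apply: heq_nat_trans; [exact: (f_equal (fun t => fst (snd t)) ey)
    |exact: (f_equal (fun t => fst (snd t)) ez)|case].
    exact: (st2 it0 it0').
  exact: (st it0).
apply: heq_pair.
  apply: heq_nat_trans; [exact: (f_equal (fun t => fst (snd (snd t))) ey)
    |exact: (f_equal (fun t => fst (snd (snd t))) ez)|case].
    exact: (st2 it1 it1').
  exact: (st it1).
apply: heq_pair.
  apply: heq_nat_trans; [exact: (f_equal (fun t => fst (snd (snd (snd t)))) ey)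
    |exact: (f_equal (fun t => fst (snd (snd (snd t)))) ez)|case].
    exact: heq_refl.
  exact: (st it0).
apply: heq_nat_trans; [exact: (f_equal (fun t => snd (snd (snd (snd t)))) ey)
  |exact: (f_equal (fun t => snd (snd (snd (snd t)))) ez)|case].
  exact: heq_refl.
exact: (st it1).
Qed.

Lemma canonical_strict (x : multicategory T) : strict (canonical_model x).
Proof.
split; rewrite ?canonical_model_gen; try exact: heq_refl.
have K a b c d (h : S_edge a b) (h' : S_edge c d) :
    heq (darr (canonical_diagram x) h) (fmap T (darr (canonical_diagram x) h')) ->
    heq (fmap (canonical_model x) (gen h))
      (fmap T (fmap (canonical_model x) (gen h'))).
  by rewrite !canonical_model_gen.
by move=> a b []; apply: K; apply: heq_refl.
Qed.

Lemma canonical_morphism_strict (x y : multicategory T) (p : multifunctor x y) :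
  strict_nat (canonical_morphism p).
Proof. by case; apply: heq_refl. Qed.
End Strict.

(** * Reconstruction of multicategories and functors from strict models *)

Section Reconstruction.
Context {B : category} {T : monad B}.

Section Diagram.
Context (b0 b1 b2 b3 : B).

(** With this object part the endpoints in the strictness conditions match by computation, so those
    conditions become ordinary equations. *)
Definition strict_obs (a : S_ob) : B :=
  match a with
  | x0 => b0 | x1 => b1 | x2 => b2 | x3 => b3
  | x0' => T b0 | x1' => T b1 | x2' => T b2
  | x0'' => T (T b0) | x1'' => T (T b1)
  end.

Context (D : forall a b, S_edge a b -> hom (strict_obs a) (strict_obs b)).

Lemma strict_diagram_canonical :
  (forall a b (p q : path S_edge a b), S_rel p q ->
    deval (Diagram D) p = deval (Diagram D) q) ->
  is_pullback (D d0_2) (D d2_2) (D d1_1) (D d0'_1) ->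
  is_pullback (D d0_3) (D d3_3) (D d2_2) (D d0'_2) ->
  D s0'_0 = fmap T (D s0_0) -> D d0'_1 = fmap T (D d0_1) ->
  D d1'_1 = fmap T (D d1_1) -> D d0'_2 = fmap T (D d0_2) ->
  D d1'_2 = fmap T (D d1_2) -> D d2'_2 = fmap T (D d2_2) ->
  D d0''_1 = fmap T (D d0'_1) ->
  D m_0 = mmul T b0 -> D m_1 = mmul T b1 ->
  D e_0 = munit T b0 -> D e_1 = munit T b1 ->
  exists x : multicategory T, canonical_diagram x = Diagram D.
Proof.
move=> R pb2 pb3 s0' d0' d1' d0'2 d1'2 d2' d0'' m0 m1 e0 e1.
rewrite d0' in pb2; rewrite d0'2 in pb3.
have r1 : D d1_1 ∘ D d1_2 = mmul T b0 ∘ fmap T (D d1_1) ∘ D d2_2.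
  by have := R _ _ _ _ rel_m_0; rewrite /= !compm1 m0 d1' compA.
have r2 : D d0_1 ∘ D d1_2 = D d0_1 ∘ D d0_2.
  by have := R _ _ _ _ rel_d0d1; rewrite /= !compm1.
have r3 : D d1_1 ∘ D s0_0 = munit T b0.
  by have := R _ _ _ _ rel_e_0; rewrite /= !compm1 e0.
have r4 : D d0_1 ∘ D s0_0 = idm b0.
  by have := R _ _ _ _ rel_ds_00; rewrite /= !compm1.
pose x := PreMulticategory pb2 r1 r2 r3 r4 pb3.
(* The four derived arrows into [x2] are recovered by comparing projections: each projection
   equation is a relation of the sketch, with primed arrows, [m_1] and [e_1] rewritten to their
   prescribed values. *)
have s01 : cs0_1 x = D s0_1.
  apply: (pullback_ext (cpb2 x)); rewrite (pairing1, pairing2) /=.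
    by have := R _ _ _ _ rel_d0s0; rewrite /= !compm1.
  by have := R _ _ _ _ rel_d2s0; rewrite /= !compm1 s0'.
have s11 : cs1_1 x = D s1_1.
  apply: (pullback_ext (cpb2 x)); rewrite (pairing1, pairing2) /=.
    by have := R _ _ _ _ rel_d0s1; rewrite /= !compm1.
  by have := R _ _ _ _ rel_e_1; rewrite /= !compm1 e1.
have d13 : cd1_3 x = D d1_3.
  apply: (pullback_ext (cpb2 x)); rewrite (pairing1, pairing2) /=.
    by have := R _ _ _ _ rel_dd_00; rewrite /= !compm1.
  by have := R _ _ _ _ rel_d'd_11; rewrite /= !compm1 d1'2.
have d23 : cd2_3 x = D d2_3.
  apply: (pullback_ext (cpb2 x)); rewrite (pairing1, pairing2) /=.
    by have := R _ _ _ _ rel_dd_10; rewrite /= !compm1.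
  by have := R _ _ _ _ rel_m_1; rewrite /= !compm1 m1 d2' compA.
have a1 : cd1_2 x ∘ cs0_1 x = idm (cob1 x).
  by rewrite s01; have := R _ _ _ _ rel_ds_10; rewrite /= !compm1.
have a2 : cd1_2 x ∘ cs1_1 x = idm (cob1 x).
  by rewrite s11; have := R _ _ _ _ rel_ds_11; rewrite /= !compm1.
have a3 : cd1_2 x ∘ cd1_3 x = cd1_2 x ∘ cd2_3 x.
  by rewrite d13 d23; have := R _ _ _ _ rel_dd_11; rewrite /= !compm1.
exists (Multicategory a1 a2 a3); rewrite /canonical_diagram.
apply: (f_equal (fun A => Diagram (dob := strict_obs) A)).
apply: functional_extensionality_dep => a; apply: functional_extensionality_dep => b.
apply: functional_extensionality_dep => -[] /=;
  by rewrite ?s01 ?s11 ?d13 ?d23 ?m0 ?m1 ?e0 ?e1 ?d0'' ?s0' ?d0' ?d1' ?d0'2 ?d1'2 ?d2'.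
Qed.
End Diagram.

Lemma strict_model_canonical (y : functor S B) :
  is_model y -> strict (T := T) y -> exists x : multicategory T, canonical_model x = y.
Proof.
move=> my sy.
have [b0 [b1 [b2 [b3 ey]]]] : exists b0 b1 b2 b3, fobj y = strict_obs b0 b1 b2 b3.
{ exists (y x0), (y x1), (y x2), (y x3); apply: functional_extensionality => -[] //=.
  - exact: (strict_ob it0 sy).
  - exact: (strict_ob it1 sy).
  - exact: (strict_ob it2 sy).
  - by rewrite (strict_ob it0' sy) (strict_ob it0 sy).
  - by rewrite (strict_ob it1' sy) (strict_ob it1 sy). }
(* Replacing the object map by [strict_obs] itself makes every [heq] in [sy] homogeneous, so
   [heq_eq] applies below. *)
case: y ey my sy => ob fm f1 fM /= ey; subst ob.
set y := Functor f1 fM => my sy.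
pose D a b (f : S_edge a b) : hom (strict_obs b0 b1 b2 b3 a) (strict_obs b0 b1 b2 b3 b)
  := fmap y (gen f).
have [x ex] : exists x : multicategory T, canonical_diagram x = Diagram D.
{ apply: strict_diagram_canonical.
  - exact: (@model_relation _ y).
  - exact: (proj1 my).
  - exact: (proj1 (proj2 my)).
  - exact: (heq_eq (strict_T sy it_s0_0)).
  - exact: (heq_eq (strict_T sy it_d0_1)).
  - exact: (heq_eq (strict_T sy it_d1_1)).
  - exact: (heq_eq (strict_T sy it_d0_2)).
  - exact: (heq_eq (strict_T sy it_d1_2)).
  - exact: (heq_eq (strict_T sy it_d2_2)).
  - exact: (heq_eq (strict_T sy it_d0'_1)).
  - exact: (heq_eq (strict_m0 sy)).
  - exact: (heq_eq (strict_m1 sy)).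
  - exact: (heq_eq (strict_e0 sy)).
  - exact: (heq_eq (strict_e1 sy)). }
exists x; apply: presented_functor_ext => [a|a b f].
  exact: (f_equal (fun A : diagram S_edge B => A a) ex).
have -> : fmap (canonical_model x) (generator S_rel f) = darr (canonical_diagram x) f.
  exact: canonical_model_gen.
have : heq (darr (canonical_diagram x) f) (darr (Diagram D) f).
  by rewrite ex; apply: heq_refl.
exact.
Qed.

(** The components at [x0] and [x1] give the functor; those at [x2] and [x3] are forced by the
    pullbacks, and the primed ones by strictness. *)
Lemma strict_nat_canonical (x y : multicategory T)
  (t : nat_trans (canonical_model x) (canonical_model y)) :
  strict_nat (T := T) t -> exists p : multifunctor x y, canonical_morphism p = t.
Proof.
move=> st.
have n a b (f : S_edge a b) :
    t b ∘ darr (canonical_diagram x) f = darr (canonical_diagram y) f ∘ t a.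
  by rewrite -!canonical_model_gen; exact: (naturality t (gen f)).
pose t0 : hom (cob0 x) (cob0 y) := t (x0 : S).
pose t1 : hom (cob1 x) (cob1 y) := t (x1 : S).
have e0 : t (x0' : S) = fmap T t0 := heq_eq (st it0).
have e1 : t (x1' : S) = fmap T t1 := heq_eq (st it1).
have e2 : t (x2' : S) = fmap T (t (x2 : S)) := heq_eq (st it2).
have e0' : t (x0'' : S) = fmap T (t (x0' : S)) := heq_eq (st it0').
have e1' : t (x1'' : S) = fmap T (t (x1' : S)) := heq_eq (st it1').
have p0 : cd0_1 y ∘ t1 = t0 ∘ cd0_1 x by have := n _ _ d0_1.
have p1 : cd1_1 y ∘ t1 = fmap T t0 ∘ cd1_1 x by have := n _ _ d1_1; rewrite e0.
pose p := PreMultifunctor p0 p1.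
have m2 : mf2 p = t (x2 : S).
  apply: (pullback_ext (cpb2 y)); rewrite (pairing1, pairing2) /=.
    exact: (n _ _ d0_2).
  by have := n _ _ d2_2; rewrite e1.
have m3 : mf3 p = t (x3 : S).
  apply: (pullback_ext (cpb3 y)); rewrite (pairing1, pairing2) /= m2.
    exact: (n _ _ d0_3).
  by have := n _ _ d3_3; rewrite e2.
have q0 : mf1 p ∘ cs0_0 x = cs0_0 y ∘ mf0 p by have := n _ _ s0_0.
have q1 : mf1 p ∘ cd1_2 x = cd1_2 y ∘ mf2 p by have := n _ _ d1_2; rewrite m2.
exists (Multifunctor q0 q1); apply: nat_trans_eq => -[] //=.
- by rewrite m2 e2.
- by rewrite e0' e0.
- by rewrite e1' e1.
Qed.

Lemma canonical_faithful (x y : multicategory T) (p q : multifunctor x y) :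
  canonical_morphism p = canonical_morphism q -> p = q.
Proof.
move=> e; apply: multifunctor_eq.
  exact: (f_equal (fun t : nat_trans _ _ => t (x0 : S)) e).
exact: (f_equal (fun t : nat_trans _ _ => t (x1 : S)) e).
Qed.

(** The specified pullbacks are visible in the model: all four objects and eight arrows stored in a
    multicategory are values of it. The remaining fields are propositions. *)
Lemma canonical_injective (x y : multicategory T) :
  canonical_model x = canonical_model y -> x = y.
Proof.
move=> e.
have ob (a : S_ob) : canonical_ob x a = canonical_ob y a.
  exact: (f_equal (fun F : functor S B => F a) e).
have ar a b (f : S_edge a b) :
    heq (darr (canonical_diagram x) f) (darr (canonical_diagram y) f).
  by rewrite -!canonical_model_gen; exact: (heq_functor (gen f) e).
case: x y {e} ob ar => [x a1 a2 a3] [y c1 c2 c3] ob ar.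
suff e : x = y by subst y; f_equal; apply: proof_irrelevance.
case: x a1 a2 a3 ob ar => ? ? ? ? ? ? ? ? ? ? ? ? ? ? ? ? ? ? a1 a2 a3.
case: y c1 c2 c3 => ? ? ? ? ? ? ? ? ? ? ? ? ? ? ? ? ? ? c1 c2 c3 ob ar.
(* Objects are identified first, so that the comparisons of arrows become homogeneous. *)
have := ob x0; have := ob x1; have := ob x2; have := ob x3 => /= ? ? ? ?; subst.
have /heq_eq /= ? := ar _ _ d1_1; have /heq_eq /= ? := ar _ _ d0_1.
have /heq_eq /= ? := ar _ _ d0_2; have /heq_eq /= ? := ar _ _ d2_2.
have /heq_eq /= ? := ar _ _ d1_2; have /heq_eq /= ? := ar _ _ s0_0.
have /heq_eq /= ? := ar _ _ d0_3; have /heq_eq /= ? := ar _ _ d3_3.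
subst; f_equal; exact: proof_irrelevance.
Qed.
End Reconstruction.

(** * Pullbacks of multicategories *)

Section CatPullbacks.
Context {B : category} {T : monad B} (cT : cartesian_monad T).
Context {x y z : Cat T} (f : hom x z) (g : hom y z).

(** A strict vertex and strict projections come from [Cat T]. The universal property descends as
    well, since the arrow induced in [Mod] by strict arrows is itself strict. *)
Lemma strict_pullback_Cat (P : functor S B)
  (p1 : nat_trans P (canonical_model x)) (p2 : nat_trans P (canonical_model y)) :
  is_model P -> strict (T := T) P -> strict_nat (T := T) p1 ->
  strict_nat (T := T) p2 ->
  (forall a : S, is_pullback (p1 a) (p2 a)
    (canonical_morphism f a) (canonical_morphism g a)) ->
  exists (w : Cat T) (q1 : hom w x) (q2 : hom w y), is_pullback q1 q2 f g /\
    is_pullback (fmap (canonical cT) q1) (fmap (canonical cT) q2)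
      (fmap (canonical cT) f) (fmap (canonical cT) g).
Proof.
move=> mP sP s1 s2 pb; have [w ew] := strict_model_canonical mP sP; subst P.
have [q1 e1] := strict_nat_canonical s1; have [q2 e2] := strict_nat_canonical s2.
subst p1 p2; exists w, q1, q2.
have pbK : is_pullback (fmap (canonical cT) q1) (fmap (canonical cT) q2)
    (fmap (canonical cT) f) (fmap (canonical cT) g).
  by apply: Mod_pullback; apply: nat_trans_pullback.
split=> //; split.
  apply: canonical_faithful; have := proj1 pbK; by rewrite -!fmapM.
move=> v u1 u2 e.
have eK : fmap (canonical cT) f ∘ fmap (canonical cT) u1 =
    fmap (canonical cT) g ∘ fmap (canonical cT) u2 by rewrite -!fmapM e.
pose t : nat_trans (canonical_model v) (canonical_model w) := pairing pbK eK.
have t1 a : canonical_morphism q1 a ∘ t a = canonical_morphism u1 a.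
  exact: (f_equal (fun s : nat_trans (canonical_model v) (canonical_model x) => s a)
    (pairing1 pbK eK)).
have t2 a : canonical_morphism q2 a ∘ t a = canonical_morphism u2 a.
  exact: (f_equal (fun s : nat_trans (canonical_model v) (canonical_model y) => s a)
    (pairing2 pbK eK)).
(* At a primed object, [t] and the [T]-image of its unprimed component have the same composites with
   both projections, so they agree because the square there is a pullback. *)
have st : strict_nat (T := T) t.
{ have E a (t' : hom (canonical_model v a) (canonical_model w a)) :
      canonical_morphism q1 a ∘ t' = canonical_morphism u1 a ->
      canonical_morphism q2 a ∘ t' = canonical_morphism u2 a -> t a = t'.
    by move=> h1 h2; apply: (pullback_ext (pb a)); rewrite ?h1 ?h2.
  have F1 a : fmap T (canonical_morphism q1 a) ∘ fmap T (t a) =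
      fmap T (canonical_morphism u1 a) by rewrite -fmapM t1.
  have F2 a : fmap T (canonical_morphism q2 a) ∘ fmap T (t a) =
      fmap T (canonical_morphism u2 a) by rewrite -fmapM t2.
  case; apply: eq_heq.
  - exact: (E x0' _ (F1 x0) (F2 x0)).
  - exact: (E x1' _ (F1 x1) (F2 x1)).
  - exact: (E x2' _ (F1 x2) (F2 x2)).
  - exact: (E x0'' _ (F1 x0') (F2 x0')).
  - exact: (E x1'' _ (F1 x1') (F2 x1')). }
have [l el] := strict_nat_canonical st.
exists l; split.
  by split; apply: canonical_faithful; apply: nat_trans_eq => a;
    [rewrite -t1|rewrite -t2]; rewrite -el; case: a => /=;
    rewrite ?mf2_comp ?mf3_comp ?fmapM.
move=> l' [el1 el2]; apply: canonical_faithful; rewrite el.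
apply: (pullback_ext pbK (z := canonical cT v) (w := t)
  (w' := fmap (canonical cT) l')); rewrite (pairing1, pairing2).
  by rewrite -el1 fmapM.
by rewrite -el2 fmapM.
Qed.

Lemma Cat_pullback (hB : has_pullbacks B) :
  exists (w : Cat T) (q1 : hom w x) (q2 : hom w y), is_pullback q1 q2 f g /\
    is_pullback (fmap (canonical cT) q1) (fmap (canonical cT) q2)
      (fmap (canonical cT) f) (fmap (canonical cT) g).
Proof.
(* Pullbacks are chosen only at the four unprimed objects; the cones elsewhere are their images
   under [T] and [TT], again pullbacks since [T] preserves them. *)
have [b0 [h0 [k0 pb0]]] := hB _ _ _ (mf0 f) (mf0 g).
have [b1 [h1 [k1 pb1]]] := hB _ _ _ (mf1 f) (mf1 g).
have [b2 [h2 [k2 pb2]]] := hB _ _ _ (mf2 f) (mf2 g).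
have [b3 [h3 [k3 pb3]]] := hB _ _ _ (mf3 f) (mf3 g).
have pT := proj1 cT.
pose P : S -> B := strict_obs (T := T) b0 b1 b2 b3.
pose p1 (a : S) : hom (P a) (canonical_model x a) :=
  match a with
  | x0 => h0 | x1 => h1 | x2 => h2 | x3 => h3
  | x0' => fmap T h0 | x1' => fmap T h1 | x2' => fmap T h2
  | x0'' => fmap T (fmap T h0) | x1'' => fmap T (fmap T h1)
  end.
pose p2 (a : S) : hom (P a) (canonical_model y a) :=
  match a with
  | x0 => k0 | x1 => k1 | x2 => k2 | x3 => k3
  | x0' => fmap T k0 | x1' => fmap T k1 | x2' => fmap T k2
  | x0'' => fmap T (fmap T k0) | x1'' => fmap T (fmap T k1)
  end.
have pb a : is_pullback (p1 a) (p2 a) (canonical_morphism f a) (canonical_morphism g a).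
  case: a => //=; [exact: (pT _ _ _ _ _ _ _ _ pb0)|exact: (pT _ _ _ _ _ _ _ _ pb1)
    |exact: (pT _ _ _ _ _ _ _ _ pb2)
    |exact: (pT _ _ _ _ _ _ _ _ (pT _ _ _ _ _ _ _ _ pb0))
    |exact: (pT _ _ _ _ _ _ _ _ (pT _ _ _ _ _ _ _ _ pb1))].
pose Q := pointwise_pullback pb.
have n1 a b (h : S_edge a b) :
    p1 b ∘ fmap Q (gen h) = darr (canonical_diagram x) h ∘ p1 a.
  by rewrite -canonical_model_gen; exact: pairing1.
have n2 a b (h : S_edge a b) :
    p2 b ∘ fmap Q (gen h) = darr (canonical_diagram y) h ∘ p2 a.
  by rewrite -canonical_model_gen; exact: pairing2.
(* The arrow of [Q] at a generator is identified by its two projections, so each strictness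
   condition reduces to two equations in [x] and [y]. *)
have E a b (h : S_edge a b) (u : hom (P a) (P b)) :
    p1 b ∘ u = darr (canonical_diagram x) h ∘ p1 a ->
    p2 b ∘ u = darr (canonical_diagram y) h ∘ p2 a ->
    heq (fmap Q (gen h)) u.
  by move=> e1 e2; apply: eq_heq; apply: (pullback_ext (pb b)); rewrite ?n1 ?n2.
have nT1 a b (h : S_edge a b) : fmap T (p1 b) ∘ fmap T (fmap Q (gen h)) =
    fmap T (darr (canonical_diagram x) h) ∘ fmap T (p1 a).
  by rewrite -!fmapM n1.
have nT2 a b (h : S_edge a b) : fmap T (p2 b) ∘ fmap T (fmap Q (gen h)) =
    fmap T (darr (canonical_diagram y) h) ∘ fmap T (p2 a).
  by rewrite -!fmapM n2.
apply: (strict_pullback_Cat (P := Q) (p1 := pointwise_fst pb)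
  (p2 := pointwise_snd pb)) => //.
- exact: (pointwise_is_model (p1 := pointwise_fst pb) (p2 := pointwise_snd pb) pb
    (canonical_is_model cT x) (canonical_is_model cT y) (canonical_is_model cT z)).
- split.
  + move=> a b [].
    * exact: (E _ _ s0'_0 _ (nT1 _ _ s0_0) (nT2 _ _ s0_0)).
    * exact: (E _ _ d0'_1 _ (nT1 _ _ d0_1) (nT2 _ _ d0_1)).
    * exact: (E _ _ d1'_1 _ (nT1 _ _ d1_1) (nT2 _ _ d1_1)).
    * exact: (E _ _ d0'_2 _ (nT1 _ _ d0_2) (nT2 _ _ d0_2)).
    * exact: (E _ _ d1'_2 _ (nT1 _ _ d1_2) (nT2 _ _ d1_2)).
    * exact: (E _ _ d2'_2 _ (nT1 _ _ d2_2) (nT2 _ _ d2_2)).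
    * exact: (E _ _ d0''_1 _ (nT1 _ _ d0'_1) (nT2 _ _ d0'_1)).
  (* For [m_i] and [e_i] these equations are naturality squares of the multiplication and unit at
     the projections. *)
  + by apply: (E _ _ m_0); rewrite /= (naturality (mmul T)).
  + by apply: (E _ _ m_1); rewrite /= (naturality (mmul T)).
  + by apply: (E _ _ e_0); rewrite /= -(naturality (munit T)).
  + by apply: (E _ _ e_1); rewrite /= -(naturality (munit T)).
- by case; apply: heq_refl.
- by case; apply: heq_refl.
Qed.
End CatPullbacks.

(** * Preservation by both composites, the strict equalizer, and pullbacks in [Cat T] *)

Theorem lemma3p1 (B : category) (hB : has_pullbacks B) (T : monad B)
  (cT : cartesian_monad T) :
  preserves_pullbacks (S_star B ⊚ Mod_inclusion B) /\
  preserves_pullbacks (Phi T ⊚ Mod_inclusion B) /\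
  is_equalizer (canonical cT)
    (S_star B ⊚ Mod_inclusion B) (Phi T ⊚ Mod_inclusion B) /\
  has_pullbacks (Cat T) /\
  preserves_pullbacks (canonical cT).
Proof.
split.
  apply: preserves_pullbacks_intro => X Y Z f g.
  have [P [p1 [p2 [pbM pb]]]] := Mod_pointwise_pullback hB f g.
  exists P, p1, p2; split=> //; exact: (S_star_pullback pb).
split.
  apply: preserves_pullbacks_intro => X Y Z f g.
  have [P [p1 [p2 [pbM pb]]]] := Mod_pointwise_pullback hB f g.
  exists P, p1, p2; split=> //; exact: (Phi_pullback pb (proj1 cT)).
split; last split.
- apply: is_equalizer_intro.
  + apply: functor_eq => [x|x y p].
      exact: (proj2 (strict_eq _) (canonical_strict x)).
    exact: (proj2 (strict_nat_eq _ (canonical_strict x) (canonical_strict y))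
      (canonical_morphism_strict p)).
  + by move=> x y e; apply: canonical_injective; exact: (f_equal (@proj1_sig _ _) e).
  + exact: canonical_faithful.
  (* Equalized models are exactly the strict ones; the proof of [is_model] is irrelevant. *)
  + case=> y my /strict_eq sy; have [x ex] := strict_model_canonical my sy.
    exists x; subst y; congr exist; exact: proof_irrelevance.
  + move=> x y t /(proj1 (strict_nat_eq _ (canonical_strict x) (canonical_strict y))).
    exact: strict_nat_canonical.
- move=> x y z f g; have [w [q1 [q2 [pb _]]]] := Cat_pullback cT f g hB.
  by exists w, q1, q2.
- by apply: preserves_pullbacks_intro => x y z f g; exact: Cat_pullback.
Qed.
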